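(* Let $b,\Delta\in R=\mathbb{F}_{2^n}[T]$ with $b\neq0$ and $\Delta\notin\varphi(R)$, where $\varphi(t)=t^2+bt$. Suppose $[R\alpha\oplus R\beta]\in C_2(b,\Delta)$ with $\frac{\alpha}{\beta}=\frac{\eta+k}{a}$, $a,k\in R$, $a\mid\Delta+k^2+bk$. Then $$\frac{\beta}{\alpha}=\frac{a}{\eta+k}=\frac{\eta+k+b}{\left(\frac{\Delta+k^2+bk}{a}\right)},\qquad \frac{\Delta+k^2+bk}{a}\in R,$$ and exactly one of $k,k+b$ lies in $R_b$. Define $$\Pi([R\alpha\oplus R\beta]):=\begin{cases}[(a,b,\frac{\Delta+k^2+bk}{a})],&\text{if }k\in R_b;\\ [(\frac{\Delta+k^2+bk}{a},b,a)],&\text{if }k+b\in R_b.\end{cases}$$ Then $\Pi$ is a well-defined bijection from $C_2(b,\Delta)$ to $C(b,\Delta)$. Moreover, $C_2(b,\Delta)=\mathrm{Pic}(R\oplus R\eta)$, and $$\Pi([M_1M_2])=\Pi([M_1])\Pi([M_2])\quad\text{for all }[M_1],[M_2]\in C_2(b,\Delta),$$ where the multiplication on the right-hand side is direct composition of classes in $C(b,\Delta)$.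
   Context: $R=\mathbb{F}_{2^n}[T]$, $K=\mathrm{Frac}(R)$. The triple $(a,b,c)\in R^3$ denotes the binary quadratic form $ax^2+bxy+cy^2$; it is primitive if $a,b,c$ have no common non-unit divisor. Fix a subgroup $G$ of $(\mathbb{F}_{2^n},+)$ with $\#G=2^{n-1}$ and $1\notin G$, and set $R_b=\{qb+r : q,r\in R,\ \deg r<\deg b,\ q(0)\in G\}$ (with $\deg0=-\infty$), a subgroup of $(R,+)$. For $\gamma=\begin{pmatrix} p & q \\ r & s \end{pmatrix}\in Sl_2(R)$ put $\gamma(a,b,c)=(ap^2+bpq+cq^2,\ b,\ ar^2+brs+cs^2)$. Primitive forms $(a,b,c)$ and $(A,b,C)$ are properly equivalent if there is such a $\gamma$ with $\gamma(a,b,c)=(A,b,C)$ and $apr+bqr+cqs\in R_b$. This is an equivalence relation; $[(a,b,c)]$ denotes the class. $C(b,\Delta)=\{[(a,b,c)] : (a,b,c)\text{ primitive},\ a,c\in R,\ ac\equiv\Delta\bmod\varphi(R)\}$. A form $(a_3,b,c_3)$ is a direct composition of $(a_1,b,c_1)$ and $(a_2,b,c_2)$ if there exist $p_i,q_i,r_i,s_i\in R$ ($i=1,2$) such that, as polynomials in $x,y,z,w$, $$(a_1x^2+bxy+c_1y^2)(a_2z^2+bzw+c_2w^2)=a_3L_1^2+bL_1L_2+c_3L_2^2,\quad L_i=p_ixz+q_ixw+r_iyz+s_iyw,$$ and $q_1r_2+q_2r_1\in R_b$, $p_2s_1+q_2r_1\in R_b$. Direct composition induces a well-defined operation on $C(b,\Delta)$: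 $[(a_1,b,c_1)][(a_2,b,c_2)]=[(a_3,b,c_3)]$ for any direct composition $(a_3,b,c_3)$. $K(\eta)$ is the quadratic extension of $K$ where $\eta$ has minimal polynomial $x^2+bx+\Delta$. Fractional ideals are those of the ring $R\oplus R\eta$. Fractional ideals $M,M'$ are equivalent if $M=\alpha M'$ for some nonzero $\alpha\in K(\eta)$; $[M]$ is the class. For every fractional ideal of the form $R\alpha\oplus R\beta$ one has $\frac{\alpha}{\beta}=\frac{\eta+k}{a}$ for some $k,a\in R$ with $a\mid\Delta+k^2+bk$. $$C_2(b,\Delta)=\left\{\left[R\oplus R\tfrac{\eta+k}{a}\right] : a,k\in R,\ a\mid\Delta+k^2+bk,\ \text{and } a,b,\tfrac{\Delta+k^2+bk}{a}\text{ are coprime (no common non-unit divisor)}\right\},$$ $$\mathrm{Pic}(R\oplus R\eta)=\{[M] : M\text{ an invertible fractional ideal of }R\oplus R\eta\}.$$ *)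

(* Defs.v *)
From HB Require Import structures.
From mathcomp Require Import all_boot all_order all_algebra all_field.
From mathcomp Require Import boolp classical_sets functions.
From mathcomp Require Import mpoly.

Set Implicit Arguments.
Unset Strict Implicit.
Unset Printing Implicit Defensive.

Import GRing.Theory.

Local Open Scope classical_set_scope.
Local Open Scope ring_scope.

Section Forms.

Variable F : finFieldType.
Local Notation R := {poly F}.

(* For b != 0 the condition deg r < deg b, with deg 0 = -oo, is
   size r < size b. *)
Definition Rsub (G : {set F}) (b : R) : set R :=
  [set u | exists q r : R,
     [/\ u = q * b + r, (size r < size b)%N & q.[0] \in G]].

Definition phi (b t : R) : R := t ^+ 2 + b * t.

Definition no_common_divisor (a b c : R) : Prop :=
  forall d : R, d %| a -> d %| b -> d %| c -> d \is a GRing.unit.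

(* The triple (a, b, c) stands for a x^2 + b x y + c y^2. *)
Definition bqform : Type := (R * R * R)%type.

Definition primitive_form (f : bqform) : Prop :=
  let: (a, b, c) := f in no_common_divisor a b c.

Definition act_form (g : 'M[R]_2) (f : bqform) : bqform :=
  let: (a, b, c) := f in
  let p := g 0 0 in let q := g 0 1 in let r := g 1 0 in let s := g 1 1 in
  (a * p ^+ 2 + b * p * q + c * q ^+ 2, b, a * r ^+ 2 + b * r * s + c * s ^+ 2).

Definition proper_factor (G : {set F}) (g : 'M[R]_2) (f : bqform) : Prop :=
  let: (a, b, c) := f in
  let p := g 0 0 in let q := g 0 1 in let r := g 1 0 in let s := g 1 1 in
  Rsub G b (a * p * r + b * q * r + c * q * s).

Definition proper_equiv (G : {set F}) (f f' : bqform) : Prop :=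
  [/\ primitive_form f, primitive_form f' &
   exists g : 'M[R]_2, [/\ \det g = 1, act_form g f = f' & proper_factor G g f]].

Definition form_class (G : {set F}) (f : bqform) : set bqform :=
  [set f' | proper_equiv G f f'].

Definition CForms (G : {set F}) (b Delta : R) : set (set bqform) :=
  [set X | exists a c : R,
     [/\ primitive_form (a, b, c), range (phi b) (a * c - Delta) &
         X = form_class G (a, b, c)]].

Definition eval_form (f : bqform) (x y : {mpoly R[4]}) : {mpoly R[4]} :=
  let: (a, b, c) := f in
  mpolyC 4 a * x ^+ 2 + mpolyC 4 b * x * y + mpolyC 4 c * y ^+ 2.

Definition direct_composition (G : {set F}) (b a1 c1 a2 c2 a3 c3 : R) : Prop :=
  exists p1 q1 r1 s1 p2 q2 r2 s2 : R,
    let X i : {mpoly R[4]} := 'X_(inord i) in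
    let x := X 0%N in let y := X 1%N in let z := X 2%N in let w := X 3%N in
    let bilin p q r s := mpolyC 4 p * x * z + mpolyC 4 q * x * w
                         + mpolyC 4 r * y * z + mpolyC 4 s * y * w in
    [/\ eval_form (a1, b, c1) x y * eval_form (a2, b, c2) z w
          = eval_form (a3, b, c3) (bilin p1 q1 r1 s1) (bilin p2 q2 r2 s2),
        Rsub G b (q1 * r2 + q2 * r1) &
        Rsub G b (p2 * s1 + q2 * r1)].

(* The union of the classes of all direct compositions of a form in X1 and a
   form in X2. Such a union is a single class exactly when a direct
   composition exists and its class does not depend on the choices. *)
Definition class_mul (G : {set F}) (b : R) (X1 X2 : set bqform) : set bqform :=
  [set f | exists a1 c1 a2 c2 a3 c3 : R,
     [/\ X1 (a1, b, c1), X2 (a2, b, c2),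
         direct_composition G b a1 c1 a2 c2 a3 c3 &
         form_class G (a3, b, c3) f]].

End Forms.

Section Ideals.

Variables (F : finFieldType) (L : fieldExtType {fraction {poly F}}).
Local Notation R := {poly F}.

Definition emb (x : R) : L := (tofrac x)%:A.

Definition lattice (alpha beta : L) : set L :=
  [set z | exists x y : R, z = emb x * alpha + emb y * beta].

(* The sum R alpha + R beta is direct, with both summands free of rank 1. *)
Definition direct_sum (alpha beta : L) : Prop :=
  forall x y : R, emb x * alpha + emb y * beta = 0 -> x = 0 /\ y = 0.

Definition order_eta (eta : L) : set L := lattice 1 eta.

Definition fractional_ideal (eta : L) (M : set L) : Prop :=
  [/\ M 0,
      forall u v, M u -> M v -> M (u + v),
      forall o u, order_eta eta o -> M u -> M (o * u),
      exists2 u, M u & u != 0 &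
      exists d, [/\ order_eta eta d, d != 0 &
                    forall u, M u -> order_eta eta (d * u)]].

Definition ideal_class (eta : L) (M : set L) : set (set L) :=
  [set M' | fractional_ideal eta M' /\
     exists2 alpha : L, alpha != 0 & M = [set alpha * z | z in M']].

Definition ideal_mul (M N : set L) : set L :=
  [set z | exists (m : nat) (u v : 'I_m -> L),
     [/\ forall i, M (u i), forall i, N (v i) & z = \sum_i u i * v i]].

Definition invertible (eta : L) (M : set L) : Prop :=
  exists2 N, fractional_ideal eta N & ideal_mul M N = order_eta eta.

Definition Pic (eta : L) : set (set (set L)) :=
  [set X | exists M, [/\ fractional_ideal eta M, invertible eta M &
                         X = ideal_class eta M]].

Definition C2 (b Delta : R) (eta : L) : set (set (set L)) :=
  [set X | exists a k : R,
     [/\ a %| Delta + k ^+ 2 + b * k,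
         no_common_divisor a b ((Delta + k ^+ 2 + b * k) %/ a) &
         X = ideal_class eta (lattice 1 ((eta + emb k) / emb a))]].

Definition in_C2_with_ratio (b Delta : R) (eta alpha beta : L) (a k : R) :
    Prop :=
  [/\ direct_sum alpha beta,
      C2 b Delta eta (ideal_class eta (lattice alpha beta)),
      alpha / beta = (eta + emb k) / emb a &
      a %| Delta + k ^+ 2 + b * k].

End Ideals.

Arguments emb {F} L x.
Arguments bqform F : clear implicits.

(* Main.v *)
Require Import Defs.
From HB Require Import structures.
From mathcomp Require Import all_boot all_order all_algebra all_field.
From mathcomp Require Import boolp classical_sets functions.
From mathcomp Require Import mpoly.
From mathcomp Require Import ring.

Set Implicit Arguments.
Unset Strict Implicit.
Unset Printing Implicit Defensive.

Import GRing.Theory.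

Local Open Scope classical_set_scope.
Local Open Scope ring_scope.

(** Write norm k = Delta + k^2 + b k, so that (eta + k)(eta + k + b) = norm
    k, since in characteristic 2 the conjugate of eta is eta + b. A form (a,
    b, c) with ac = norm k is a N(x + y t) for the number t = tau a k = (eta
    + k) / a, a root of a t^2 + b t + c. Attaching the lattice R + R t to
    the form turns proper equivalence into homothety of lattices and direct
    composition into multiplication of ideals.

    The two roots of norm X = ac are k and k + b. Since G has index 2 in F
    and misses 1, the group R_b has index 2 in R and misses b, so exactly
    one of the roots lies in R_b. Thus R_b plays the role of an orientation:
    it chooses, for each form, one of the two conjugate numbers t.

    Proper equivalence. If ps + qr = 1, then dividing the basis (p + q t, r
    + s t) of R + R t by p + q t yields a number of the shape tau a' k'
    again, where (a', b, c') is the transformed form and k' = k + (apr + bqr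
    + cqs) (change_basis). Two parameters in R_b therefore force apr + bqr +
    cqs into R_b. Conversely homothetic lattices differ by a matrix whose
    determinant is a unit, that is a constant of F; it is a square because F
    is finite of characteristic 2, so a rescaling makes the determinant 1
    (scaling_unimodular). Consequently the set of all forms attached to an
    ideal class is a single proper class (forms_of_class_tau), and this set
    is taken as the value of Pi; bijectivity is then immediate.

    Picard group. Every fractional ideal is a multiple of some R + R (tau a
    k), by a Hermite normal form argument (fractional_ideal_tau). Such a
    lattice has the order R + R eta as its ring of multipliers exactly when
    a, b, c are coprime (tau_multipliersP). An invertible ideal has this
    multiplier ring, and in the coprime case the conjugate ideal is an
    explicit inverse.

    Composition. A direct composition is a 2 x 2 x 2 cube of coefficients
    p_i, q_i, r_i, s_i. Comparing coefficients shows that the three forms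
    are given by 2 x 2 minors of the cube (composes_cube), and then the
    three parameters are related by k1 + k2 = q1 r2 + q2 r1 and k1 + k3 = p2
    s1 + q2 r1: these are the two conditions modulo R_b in the definition of
    composition. With these relations (p1 + p2 t3)(x + y t1)(z + w t2) = L1
    + L2 t3, so the product of the first two lattices is homothetic to the
    third one (cube_ideals). For existence, expressing 1, t2, t1, t1 t2 in a
    basis of the product of the two lattices gives a cube with the right
    minors up to a common unit (product_cube); exchanging the two basis
    vectors, which adds b to p2 s1 + q2 r1, achieves the second condition. *)

(** * Computing in characteristic 2 *)

Section CharTwoNumerals.

Variables (S : pzRingType) (two0 : 2 = 0 :> S).

Lemma char2_opp : -1 = 1 :> S.
Proof. by apply/esym/eqP; rewrite -subr_eq0 opprK -two0. Qed.

Lemma char2_3 : 3 = 1 :> S.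
Proof. by rewrite -[3]/(2 + 1)%:R natrD two0 add0r. Qed.

Lemma char2_4 : 4 = 0 :> S.
Proof. by rewrite -[4]/(2 + 2)%:R natrD two0 add0r. Qed.

Lemma char2_5 : 5 = 1 :> S.
Proof. by rewrite -[5]/(4 + 1)%:R natrD char2_4 add0r. Qed.

Lemma char2_6 : 6 = 0 :> S.
Proof. by rewrite -[6]/(4 + 2)%:R natrD two0 char2_4 addr0. Qed.

Lemma addrr2 (x : S) : x + x = 0.
Proof. by rewrite -mulr2n -mulr_natl two0 mul0r. Qed.

Lemma eq_addr2 (x y : S) : x + y = 0 -> x = y.
Proof. by move=> e; rewrite -[x]addr0 -(addrr2 y) addrA e add0r. Qed.

End CharTwoNumerals.

(** Decides polynomial identities modulo 2, from a proof of 2 = 0 and optional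
    equations that rewrite a monomial.  A numeral equation is used only to
    replace a coefficient that is exactly its left-hand side, hence the list of
    small numerals. *)
Tactic Notation "ring2" constr(h) :=
  ring: h (char2_opp h) (char2_3 h) (char2_4 h) (char2_5 h) (char2_6 h).
Tactic Notation "ring2" constr(h) constr(e) :=
  ring: h (char2_opp h) (char2_3 h) (char2_4 h) (char2_5 h) (char2_6 h) e.
Tactic Notation "ring2" constr(h) constr(e) constr(f) :=
  ring: h (char2_opp h) (char2_3 h) (char2_4 h) (char2_5 h) (char2_6 h) e f.
Tactic Notation "ring2" constr(h) constr(e) constr(f) constr(g) :=
  ring: h (char2_opp h) (char2_3 h) (char2_4 h) (char2_5 h) (char2_6 h) e f g.

Lemma det_mx22 (S : comNzRingType) (A : 'M[S]_2) :
  \det A = A 0 0 * A 1 1 - A 0 1 * A 1 0.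
Proof.
have e : lift 0 0 = 1 :> 'I_2 by exact: val_inj.
have e' : lift 1 0 = 0 :> 'I_2 by exact: val_inj.
rewrite (expand_det_row _ 0) !big_ord_recl big_ord0 /cofactor !det_mx11 !mxE.
by rewrite e e' /= expr0 expr1; ring.
Qed.

(** * Lattices in the extension *)

Section Embedding.

Variables (F : finFieldType) (L : fieldExtType {fraction {poly F}}).

Fact emb_is_zmod_morphism : zmod_morphism (emb L : {poly F} -> L).
Proof. by move=> x y; rewrite /emb rmorphB /= scalerBl. Qed.

Fact emb_is_monoid_morphism : monoid_morphism (emb L : {poly F} -> L).
Proof.
split=> [|x y]; first by rewrite /emb rmorph1 scale1r.
by rewrite /emb rmorphM /= -scalerAl mul1r scalerA.
Qed.

HB.instance Definition _ :=
  GRing.isZmodMorphism.Build {poly F} L (emb L) emb_is_zmod_morphism.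
HB.instance Definition _ :=
  GRing.isMonoidMorphism.Build {poly F} L (emb L) emb_is_monoid_morphism.

Lemma emb_eq0 (x : {poly F}) : (emb L x == 0) = (x == 0).
Proof. by rewrite /emb scaler_eq0 oner_eq0 orbF tofrac_eq0. Qed.

Lemma lattice_scale (lam alpha beta : L) :
  [set lam * z | z in lattice alpha beta] = lattice (lam * alpha) (lam * beta).
Proof.
apply/seteqP; split=> [_ [_ [x [y ->]] <-]|_ [x [y ->]]].
  by exists x, y; ring.
by exists (emb L x * alpha + emb L y * beta); [exists x, y | ring].
Qed.

Lemma lattice_swap (alpha beta : L) : lattice alpha beta = lattice beta alpha.
Proof. by apply/seteqP; split=> _ [x [y ->]]; exists y, x; ring. Qed.

Lemma lattice_sub (alpha beta alpha' beta' : L) :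
    lattice alpha beta alpha' -> lattice alpha beta beta' ->
  lattice alpha' beta' `<=` lattice alpha beta.
Proof.
move=> [p [q ->]] [r [s ->]] _ [x [y ->]].
by exists (x * p + y * r), (x * q + y * s); ring.
Qed.

Lemma lattice_l (alpha beta : L) : lattice alpha beta alpha.
Proof. by exists 1, 0; ring. Qed.

Lemma lattice_r (alpha beta : L) : lattice alpha beta beta.
Proof. by exists 0, 1; ring. Qed.

Lemma lattice_eq (alpha beta alpha' beta' : L) :
    lattice alpha beta alpha' -> lattice alpha beta beta' ->
    lattice alpha' beta' alpha -> lattice alpha' beta' beta ->
  lattice alpha beta = lattice alpha' beta'.
Proof. by move=> *; apply/seteqP; split; apply: lattice_sub. Qed.

Lemma lattice_comb (alpha beta u v : L) (x y : {poly F}) :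
    lattice alpha beta u -> lattice alpha beta v ->
  lattice alpha beta (emb L x * u + emb L y * v).
Proof. by move=> hu hv; apply: (lattice_sub hu hv); exists x, y. Qed.

End Embedding.

(** * Quadratic numbers attached to forms *)

Section QuadraticOrder.

Variables (F : finFieldType) (L : fieldExtType {fraction {poly F}}).
Variables (b Delta : {poly F}) (eta : L).
Hypothesis char2 : 2 = 0 :> F.
Hypothesis eta_sqr : eta ^+ 2 = emb L b * eta + emb L Delta.
Hypothesis eta_free : direct_sum 1 eta.

Local Notation R := {poly F}.
Local Notation norm k := (Delta + k ^+ 2 + b * k).

Definition tau (a k : R) : L := (eta + emb L k) / emb L a.

Lemma char2_poly : 2 = 0 :> R.
Proof. by rewrite -[2]/(2%:R) -polyC_natr char2. Qed.

Lemma char2_ext : 2 = 0 :> L.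
Proof. by rewrite -(rmorph_nat (emb L) 2) char2_poly rmorph0. Qed.

Let h2R := char2_poly.
Let h2L := char2_ext.

Lemma eta_coord (x y x' y' : R) :
  emb L x + emb L y * eta = emb L x' + emb L y' * eta -> x = x' /\ y = y'.
Proof.
move=> e; have [] := @eta_free (x - x') (y - y').
  have -> : emb L (x - x') * 1 + emb L (y - y') * eta
    = (emb L x + emb L y * eta) - (emb L x' + emb L y' * eta) by ring.
  by rewrite e subrr.
by move=> /eqP + /eqP; rewrite !subr_eq0 => /eqP -> /eqP ->.
Qed.

Lemma eta_emb_neq0 (k : R) : eta + emb L k != 0.
Proof.
apply/eqP => e; have [] := @eta_free k 1; first by rewrite -e; ring.
by move=> _ /eqP; rewrite oner_eq0.
Qed.

(** Vieta: the conjugate of eta is eta + b, because their sum has to be b. *)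
Lemma norm_conj (k : R) :
  (eta + emb L k) * (eta + emb L (k + b)) = emb L (norm k).
Proof. by ring2 h2L eta_sqr. Qed.

Lemma norm_shift (k : R) : norm (k + b) = norm k.
Proof. by ring2 h2R. Qed.

(** Its two conjugate factors do not vanish, eta being outside the fraction
    field of R. This is why the outer coefficients of a form are never zero. *)
Lemma norm_neq0 (k : R) : norm k != 0.
Proof. by rewrite -(emb_eq0 L) -norm_conj mulf_neq0 ?eta_emb_neq0. Qed.

Section Quadratic.

Variables (a c k : R).
Hypothesis ac_norm : a * c = norm k.

Lemma lead_neq0 : a != 0.
Proof.
by apply: contraTneq (norm_neq0 k) => a0; rewrite -ac_norm a0 mul0r eqxx.
Qed.

Lemma tail_neq0 : c != 0.
Proof.
by apply: contraTneq (norm_neq0 k) => c0; rewrite -ac_norm c0 mulr0 eqxx.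
Qed.

Lemma lead_tau : emb L a * tau a k = eta + emb L k.
Proof. by rewrite mulrC divfK // emb_eq0 lead_neq0. Qed.

Lemma tau_neq0 : tau a k != 0.
Proof.
by apply: contraTneq (eta_emb_neq0 k) => t0; rewrite -lead_tau t0 mulr0 eqxx.
Qed.

Lemma tau_quadratic : emb L a * tau a k ^+ 2 = emb L b * tau a k + emb L c.
Proof.
apply: (mulfI (x := emb L a)); first by rewrite emb_eq0 lead_neq0.
transitivity ((emb L a * tau a k) ^+ 2); first by ring.
have eN : emb L a * emb L c = emb L (norm k) by rewrite -ac_norm rmorphM.
rewrite mulrDr eN [emb L a * (emb L b * _)]mulrCA lead_tau.
by ring2 h2L eta_sqr.
Qed.

Lemma tau_coord (x y x' y' : R) :
  emb L x + emb L y * tau a k = emb L x' + emb L y' * tau a k ->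
  x = x' /\ y = y'.
Proof.
move=> /(congr1 ( *%R (emb L a))).
rewrite !mulrDr ![emb L a * (_ * tau a k)]mulrCA lead_tau => e.
have [] := @eta_coord (a * x + y * k) y (a * x' + y' * k) y'.
  transitivity (emb L a * emb L x + emb L y * (eta + emb L k)); first by ring.
  by rewrite e; ring.
move=> e1 e2; split=> //; move: e1; rewrite e2 => /addIr.
exact/mulfI/lead_neq0.
Qed.

(** The reversed form corresponds to 1 / tau, that is to the conjugate
    parameter k + b: this is where the second case in the definition of Pi
    comes from. *)
Lemma tau_swap : lattice 1 (tau a k)
  = [set tau a k * z | z in lattice 1 (tau c (k + b))].
Proof.
rewrite lattice_scale mulr1 lattice_swap; congr lattice.
apply: (mulfI (x := emb L a * emb L c)).
  by rewrite mulf_neq0 ?emb_eq0 ?lead_neq0 ?tail_neq0.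
have eN : emb L a * emb L c = (eta + emb L k) * (eta + emb L (k + b)).
  by rewrite norm_conj -ac_norm rmorphM.
rewrite mulr1 mulrACA lead_tau eN.
by rewrite [tau c _]/tau [emb L c * _]mulrC divfK ?emb_eq0 ?tail_neq0.
Qed.

(** After division by lam, the new basis (p + q tau, r + s tau) of the same
    lattice becomes (1, tau a' k'): multiplying (r + s tau) / (p + q tau) by
    the value a' of the form at (p, q) yields eta plus an element of R. *)
Lemma change_basis (p q r s : R) (det1 : p * s + q * r = 1)
    (a' := a * p ^+ 2 + b * p * q + c * q ^+ 2)
    (c' := a * r ^+ 2 + b * r * s + c * s ^+ 2)
    (k' := k + (a * p * r + b * q * r + c * q * s))
    (lam := emb L p + emb L q * tau a k) :
  [/\ a' * c' = norm k', lam != 0 &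
      lattice 1 (tau a k) = [set lam * z | z in lattice 1 (tau a' k')]].
Proof.
have eD : Delta = a * c + k ^+ 2 + b * k by rewrite ac_norm; ring2 h2R.
have ps : p * s = 1 + q * r by rewrite -det1; ring2 h2R.
have psL : emb L p * emb L s = 1 + emb L q * emb L r.
  by rewrite -!rmorphM ps rmorphD rmorph1.
have norm' : a' * c' = norm k' by rewrite /a' /c' /k'; ring2 h2R ps eD.
have a0 : emb L a != 0 by rewrite emb_eq0 lead_neq0.
have lam0 : lam != 0.
  apply/eqP => e; have [] := @tau_coord p q 0 0.
    by rewrite -/lam e; ring.
  move=> p0 q0; move: det1 => /eqP.
  by rewrite p0 q0 !mul0r addr0 eq_sym oner_eq0.
split=> //.
have a'0 : emb L a' != 0.
  rewrite emb_eq0; apply: contraTneq (norm_neq0 k') => e.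
  by rewrite -norm' e mul0r eqxx.
have lamt : lam * tau a' k' = emb L r + emb L s * tau a k.
  rewrite /tau mulrA; apply: (mulIf a'0); rewrite divfK //.
  rewrite /lam /tau; apply: (mulfI a0).
  transitivity ((emb L p * emb L a + emb L q * (eta + emb L k))
                 * (eta + emb L k')); first by field.
  transitivity ((emb L r * emb L a + emb L s * (eta + emb L k))
                 * emb L a'); last by field.
  have eDL : emb L Delta = emb L a * emb L c + emb L k ^+ 2 + emb L b * emb L k.
    by rewrite eD; ring.
  by rewrite /a' /k'; ring2 h2L psL eta_sqr eDL.
rewrite lattice_scale mulr1 lamt.
apply: lattice_eq.
- by exists p, q; rewrite mulr1.
- by exists r, s; rewrite mulr1.
- by exists s, q; rewrite /lam; ring2 h2L psL.
- by exists r, p; rewrite /lam; ring2 h2L psL.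
Qed.

End Quadratic.

(** * Homothetic lattices *)

(** Units of R are nonzero constants, and squaring is injective, hence
    bijective, on the finite field F of characteristic 2. *)
Lemma unit_is_square (u v : R) :
  u * v = 1 -> exists w w' : R, w * w' = 1 /\ w ^+ 2 = u.
Proof.
move=> uv; have /size_poly1P[x x0 ->] : size u == 1%N.
  have : u \is a GRing.unit by apply/unitrPr; exists v.
  by rewrite poly_unitE => /andP[].
have sqr_inj : injective (fun y : F => y ^+ 2).
  move=> y z /= e; apply: (eq_addr2 char2); apply/eqP; rewrite -sqrf_eq0.
  by apply/eqP; transitivity (y ^+ 2 + z ^+ 2); [ring2 char2 | rewrite e addrr2].
have [g _ gK] := injF_bij sqr_inj.
have g0 : g x != 0.
  by apply: contraNneq x0 => g0; rewrite -[x]gK g0 expr0n.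
exists (g x)%:P, (g x)^-1%:P; split; first by rewrite -polyCM mulfV.
by rewrite -polyC_exp gK.
Qed.

(** Converse of change_basis. The matrix between the two bases has a unit as
    its determinant; dividing it by a square root of this unit does not
    change the quotient of the basis vectors, so the determinant can be
    taken to be 1. The new coefficients are then forced by comparing
    coordinates on (1, eta). *)
Lemma scaling_unimodular (a c k a' c' k' : R) (lam : L)
    (ac_norm : a * c = norm k) (ac_norm' : a' * c' = norm k')
    (eq_lat : lattice 1 (tau a k) = [set lam * z | z in lattice 1 (tau a' k')]) :
  exists p q r s : R,
    [/\ p * s + q * r = 1, a' = a * p ^+ 2 + b * p * q + c * q ^+ 2,
        c' = a * r ^+ 2 + b * r * s + c * s ^+ 2 &
        k' = k + (a * p * r + b * q * r + c * q * s)].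
Proof.
have a0 := lead_neq0 ac_norm; have a'0 := lead_neq0 ac_norm'.
have eD : Delta = a * c + k ^+ 2 + b * k by rewrite ac_norm; ring2 h2R.
move: eq_lat; rewrite lattice_scale mulr1 => eq_lat.
have [p0 [q0 e1]] : lattice 1 (tau a k) lam by rewrite eq_lat; exact: lattice_l.
have [r0 [s0 e2]] : lattice 1 (tau a k) (lam * tau a' k').
  by rewrite eq_lat; exact: lattice_r.
have [x [y ex]] : lattice lam (lam * tau a' k') 1.
  by rewrite -eq_lat; exact: lattice_l.
have [z [w ez]] : lattice lam (lam * tau a' k') (tau a k).
  by rewrite -eq_lat; exact: lattice_r.
have [x1 y0] : 1 = x * p0 + y * r0 /\ 0 = x * q0 + y * s0.
  apply: (tau_coord ac_norm).
  by rewrite rmorph1 rmorph0 mul0r addr0 {1}ex e2 e1; ring.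
have [z0 w1] : 0 = z * p0 + w * r0 /\ 1 = z * q0 + w * s0.
  apply: (tau_coord ac_norm).
  by rewrite rmorph1 rmorph0 mul1r add0r {1}ez e2 e1; ring.
have det_unit : (p0 * s0 + q0 * r0) * (x * w + y * z) = 1.
  transitivity ((x * p0 + y * r0) * (z * q0 + w * s0)
     + (z * p0 + w * r0) * (x * q0 + y * s0)); first by ring2 h2R.
  by rewrite -x1 -y0 -w1 !(mulr0, addr0, mul1r).
have [v [v' [vv' v2]]] := unit_is_square det_unit.
pose p := v' * p0; pose q := v' * q0; pose r := v' * r0; pose s := v' * s0.
have det1 : p * s + q * r = 1.
  transitivity (v' ^+ 2 * (p0 * s0 + q0 * r0)); first by rewrite /p /q /r /s; ring.
  by rewrite -v2 -exprMn mulrC vv' expr1n.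
have key : (emb L p + emb L q * tau a k) * tau a' k'
    = emb L r + emb L s * tau a k.
  transitivity (emb L v' * (lam * tau a' k')); first by rewrite e1 /p /q; ring.
  by rewrite e2 /r /s; ring.
(* Denominators cleared: an identity between coordinates on (1, eta). *)
have {}key : (emb L p * emb L a + emb L q * (eta + emb L k)) * (eta + emb L k')
    = emb L a' * (emb L r * emb L a + emb L s * (eta + emb L k)).
  rewrite -(lead_tau ac_norm) -(lead_tau ac_norm').
  transitivity (emb L a * emb L a'
     * ((emb L p + emb L q * tau a k) * tau a' k')); first by ring.
  by rewrite key; ring.
have [E0 E1] : q * Delta + k' * (p * a + q * k) = a' * (r * a + s * k)
    /\ p * a + q * k + q * k' + q * b = a' * s.
  apply: eta_coord; transitivity ((emb L p * emb L a + emb L q * (eta + emb L k))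
     * (eta + emb L k')); first by ring2 h2L eta_sqr.
  by rewrite key; ring.
(* The two coordinates amount to (k + k') (p, q) = a' (r, s) + (qc, pa + qb);
   determinants with (p, q) and (r, s) isolate a' and k'. *)
have kp : (k + k') * p = a' * r + q * c.
  apply: (mulfI a0).
  transitivity ((q * Delta + k' * (p * a + q * k))
    + k * (p * a + q * k + q * k' + q * b) + a * (q * c)).
    by rewrite eD; ring2 h2R.
  by rewrite E0 E1; ring2 h2R.
have kq : (k + k') * q = a' * s + p * a + q * b by rewrite -E1; ring2 h2R.
exists p, q, r, s.
have ea' : a' = a * p ^+ 2 + b * p * q + c * q ^+ 2.
  apply: (eq_addr2 h2R).
  transitivity (a' * (p * s + q * r) + a * p ^+ 2 + b * p * q + c * q ^+ 2).
    by rewrite det1; ring.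
  transitivity (q * (a' * r + q * c) + p * (a' * s + p * a + q * b)).
    by ring2 h2R.
  by rewrite -kp -kq; ring2 h2R.
have ek' : k' = k + (a * p * r + b * q * r + c * q * s).
  transitivity (k + (k + k') * (p * s + q * r)).
    by rewrite det1; ring2 h2R.
  transitivity (k + (s * ((k + k') * p) + r * ((k + k') * q))); first by ring.
  by rewrite kp kq; ring2 h2R.
split=> //; apply: (mulfI a'0); rewrite ac_norm'.
by have [+ _ _] := change_basis ac_norm det1; rewrite -ea' -ek' => ->.
Qed.

(** * Ideal classes *)

Lemma image_mul1 (M : set L) : [set 1 * z | z in M] = M.
Proof.
apply/seteqP; split=> [_ [z Mz <-]|z Mz]; first by rewrite mul1r.
by exists z; rewrite ?mul1r.
Qed.

Lemma image_mulM (lam mu : L) (M : set L) :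
  [set lam * z | z in [set mu * z | z in M]] = [set lam * mu * z | z in M].
Proof.
apply/seteqP; split=> [_ [_ [z Mz <-] <-]|_ [z Mz <-]].
  by exists z; rewrite ?mulrA.
by exists (mu * z); [exists z | rewrite mulrA].
Qed.

Lemma ideal_class_scale (lam : L) (M : set L) :
  lam != 0 -> ideal_class eta [set lam * z | z in M] = ideal_class eta M.
Proof.
move=> lam0; apply/seteqP; split=> N [fN [mu mu0 e]]; split=> //.
  exists (lam^-1 * mu); first by rewrite mulf_neq0 ?invr_eq0.
  by rewrite -image_mulM -e image_mulM mulVf // image_mul1.
by exists (lam * mu); [rewrite mulf_neq0 | rewrite -image_mulM -e].
Qed.

Lemma ideal_class_eqP (M N : set L) :
  fractional_ideal eta N -> ideal_class eta M = ideal_class eta N ->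
  exists2 lam : L, lam != 0 & M = [set lam * z | z in N].
Proof.
move=> fN e; suff [] : ideal_class eta M N by [].
by rewrite e; split=> //; exists 1; rewrite ?oner_eq0 ?image_mul1.
Qed.

Lemma lattice_fractional (alpha beta d : L) :
    alpha != 0 -> d != 0 -> order_eta eta d ->
    order_eta eta (d * alpha) -> order_eta eta (d * beta) ->
    lattice alpha beta (eta * alpha) -> lattice alpha beta (eta * beta) ->
  fractional_ideal eta (lattice alpha beta).
Proof.
move=> a0 d0 Od Oda Odb ea eb; split.
- by exists 0, 0; rewrite !rmorph0 !mul0r addr0.
- move=> _ _ [x [y ->]] [z [w ->]]; exists (x + z), (y + w); ring.
- move=> _ u [x [y ->]] Mu; rewrite mulr1 mulrDl -mulrA.
  apply: lattice_comb => //; case: Mu => z [w ->].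
  by rewrite mulrDr ![eta * (emb L _ * _)]mulrCA; apply: lattice_comb.
- by exists alpha => //; exact: lattice_l.
- exists d; split=> // _ [x [y ->]].
  by rewrite mulrDr ![d * (emb L _ * _)]mulrCA; apply: lattice_comb.
Qed.

Lemma order_emb (x : R) : order_eta eta (emb L x).
Proof. by exists x, 0; ring. Qed.

Lemma tau_fractional (a c k : R) :
  a * c = norm k -> fractional_ideal eta (lattice 1 (tau a k)).
Proof.
move=> ac; have lt := lead_tau ac.
apply: (lattice_fractional (d := emb L a)).
- exact: oner_neq0.
- by rewrite emb_eq0 (lead_neq0 ac).
- exact: order_emb.
- by rewrite mulr1; exact: order_emb.
- by rewrite lt; exists k, 1; ring.
- by exists k, a; rewrite mulr1 lt; ring2 h2L.
- have e : eta = emb L a * tau a k + emb L k by rewrite lt; ring2 h2L.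
  exists c, (b + k).
  transitivity (emb L a * tau a k ^+ 2 + emb L k * tau a k).
    by rewrite [X in X * _ = _]e; ring.
  by rewrite (tau_quadratic ac); ring.
Qed.

(** * Coprimality and rings of multipliers *)

Lemma size1_unit (d : R) : d %| 1 -> d \is a GRing.unit.
Proof.
rewrite dvdp1 => /size_poly1P[x x0 ->].
by rewrite poly_unitE size_polyC x0 coefC eqxx unitfE.
Qed.

Lemma coprime3P (x y z : R) :
  no_common_divisor x y z <-> exists u v w : R, u * x + v * y + w * z = 1.
Proof.
split=> [cop|[u [v [w e]]] d dx dy dz]; last first.
  by apply: size1_unit; rewrite -e !dvdp_add ?dvdp_mull.
have /Bezout_eq1_coprimepP[[u w] /= e] : coprimep (gcdp x y) z.
  have : gcdp (gcdp x y) z \is a GRing.unit.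
    apply: cop; last exact: dvdp_gcdr.
      by apply: dvdp_trans (dvdp_gcdl _ _) (dvdp_gcdl _ _).
    by apply: dvdp_trans (dvdp_gcdl _ _) (dvdp_gcdr _ _).
  by rewrite poly_unitE => /andP[].
have [[s t] /= /eqpP[[c1 c2] /= /andP[c10 c20] est]] := Bezoutp x y.
have eg : gcdp x y = (c2^-1 * c1)%:P * (s * x + t * y).
  by rewrite mul_polyC -scalerA est scalerA mulVf // scale1r.
exists (u * (c2^-1 * c1)%:P * s), (u * (c2^-1 * c1)%:P * t), w.
by rewrite -e eg; ring.
Qed.

Definition multipliers_integral (M : set L) :=
  forall theta, (forall u, M u -> M (theta * u)) -> order_eta eta theta.

(** Having R + R eta as ring of multipliers depends on the ideal class only,
    which makes coprimality of a, b, c an invariant of the class. *)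
Lemma multipliers_integral_scale (lam : L) (M : set L) : lam != 0 ->
  multipliers_integral [set lam * z | z in M] <-> multipliers_integral M.
Proof.
move=> lam0; have inj := mulfI lam0; split=> hM theta hth; apply: hM.
  move=> _ [u Mu <-]; exists (theta * u); first exact: hth.
  by rewrite mulrCA.
move=> u Mu; have [|v Mv] := hth (lam * u); first by exists u.
by rewrite mulrCA => /inj <-.
Qed.

(** If d divides a, b and c, then (eta + k) / d is a multiplier, because a
    tau = eta + k and (eta + k) tau = b tau + c. Conversely a multiplier x +
    y tau satisfies a | yb and a | yc, hence a | y when a, b, c are coprime. *)
Lemma tau_multipliersP (a c k : R) : a * c = norm k ->
  multipliers_integral (lattice 1 (tau a k)) <-> no_common_divisor a b c.
Proof.
move=> ac; have lt := lead_tau ac; have a0 := lead_neq0 ac.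
split=> [mult d /dvdpP[a' ea] /dvdpP[b' eb] /dvdpP[c' ec]|/coprime3P].
  have d0 : d != 0 by apply: contraNneq a0 => d0; rewrite ea d0 mulr0.
  have dL0 : emb L d != 0 by rewrite emb_eq0.
  have [|x [y e]] := mult ((eta + emb L k) / emb L d).
    move=> _ [x [y ->]]; exists (y * c'), (x * a' + y * b'); apply: (mulfI dL0).
    transitivity (emb L x * (eta + emb L k)
      + emb L y * (emb L b * tau a k + emb L c)).
      have dth : emb L d * ((eta + emb L k) / emb L d) = emb L a * tau a k.
        by rewrite mulrC divfK.
      by rewrite [LHS]mulrA dth -(tau_quadratic ac) -lt; ring.
    by rewrite -lt ea eb ec; ring.
  apply: size1_unit; apply/dvdpP; exists y.
  have [_ ->] // : k = x * d /\ 1 = y * d.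
  apply: eta_coord; rewrite rmorph1 mul1r [LHS]addrC.
  have -> : eta + emb L k = (eta + emb L k) / emb L d * emb L d by rewrite divfK.
  by rewrite e; ring.
move=> [u [v [w e1]]] theta mult.
have [x [y eth]] : lattice 1 (tau a k) theta.
  by rewrite -[theta]mulr1; apply: mult; exact: lattice_l.
have [z [t etht]] : lattice 1 (tau a k) (theta * tau a k).
  by apply: mult; exact: lattice_r.
have [yc yb] : y * c = a * z /\ x * a + y * b = a * t.
  apply: (tau_coord ac); transitivity (emb L a * (theta * tau a k)).
    transitivity (emb L x * (emb L a * tau a k)
       + emb L y * (emb L b * tau a k + emb L c)); first by ring.
    by rewrite -(tau_quadratic ac) eth; ring.
  by rewrite etht; ring.
pose m := u * y + v * (t - x) + w * z.
have ey : y = m * a.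
  transitivity (y * (u * x * 0 + (u * a + v * b + w * c))).
    by rewrite e1; ring.
  transitivity (y * u * a + v * (x * a + y * b - x * a) + w * (y * c)).
    by ring.
  by rewrite yb yc /m; ring.
exists (x + m * k), m; rewrite eth ey.
transitivity (emb L x + emb L m * (emb L a * tau a k)); first by ring.
by rewrite lt; ring.
Qed.

(** * Normal form of fractional ideals *)

Lemma principal_ideal (P : set R) (x0 : R) :
    P x0 -> x0 != 0 -> (forall x y, P x -> P y -> P (x + y)) ->
    (forall r x, P x -> P (r * x)) ->
  exists g, [/\ P g, g != 0 & forall x, P x -> g %| x].
Proof.
move=> Px0 x00 PD PM.
pose Q n := `[< exists x, [/\ P x, x != 0 & size x = n] >].
have exQ : exists n, Q n by exists (size x0); apply/asboolP; exists x0.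
case: (ex_minnP exQ) => n /asboolP[g [Pg g0 sg]] gmin.
exists g; split=> // x Px; apply/modp_eq0P/eqP; apply: contraTT isT => r0.
have : (n <= size (x %% g)%R)%N.
  apply: gmin; apply/asboolP; exists (x %% g); split=> //.
  have -> : x %% g = x + (- (x %/ g)) * g.
    by rewrite {2}[x](divp_eq x g); ring.
  by apply: PD => //; exact: PM.
by rewrite -sg leqNgt ltn_modp g0.
Qed.

(** Hermite normal form: after clearing denominators, the ideal is spanned
    by x1 and x0 + y0 eta, where y0 generates the ideal of eta-coordinates
    and x1 the ideal of elements of R. Stability under eta makes y0 divide
    x1 and x0; the quotients are a and k, and stability under the conjugate
    gives a | norm k. *)
Lemma fractional_ideal_tau (M : set L) : fractional_ideal eta M ->
  exists a c k lam, [/\ a * c = norm k, lam != 0 &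
    M = [set lam * z | z in lattice 1 (tau a k)]].
Proof.
move=> [M0 MD MO [u Mu u0] [d [Od d0 dM]]].
pose I := [set d * z | z in M].
have ID v w : I v -> I w -> I (v + w).
  move=> [v' Mv <-] [w' Mw <-]; exists (v' + w'); first exact: MD.
  by rewrite mulrDr.
have IO o v : order_eta eta o -> I v -> I (o * v).
  by move=> Oo [v' Mv <-]; exists (o * v'); [exact: MO | rewrite mulrCA].
have IR r v : I v -> I (emb L r * v) by apply: IO; exact: order_emb.
have Oeta : order_eta eta eta by exists 0, 1; ring.
(* The norm of a nonzero element makes both coordinate ideals nonzero. *)
have [N IN N0] : exists2 N, I (emb L N) & N != 0.
  have [x [y e]] := dM u Mu.
  have e' : emb L (x ^+ 2 + b * x * y + Delta * y ^+ 2)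
      = (emb L (x + b * y) + emb L y * eta) * (d * u).
    by rewrite e; ring2 h2L eta_sqr.
  exists (x ^+ 2 + b * x * y + Delta * y ^+ 2).
    by rewrite e'; apply: IO; [exists (x + b * y), y; ring | exists u].
  rewrite -(emb_eq0 L) e'; apply: mulf_neq0; last exact: mulf_neq0.
  apply/eqP => z; have [] := @eta_free (x + b * y) y; first by rewrite -z; ring.
  move=> xy y0; move: xy e; rewrite y0 mulr0 addr0 => -> /eqP.
  by rewrite rmorph0 !mul0r addr0 mulf_eq0 (negPf d0) (negPf u0).
pose A := [set y : R | exists x : R, I (emb L x + emb L y * eta)].
pose B := [set x : R | I (emb L x)].
have [|x y [x' Ix] [y' Iy]|r x [x' Ix]|y0 [[x0 I0] y00 Amin]] :=
    @principal_ideal A N _ N0.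
- by exists 0; rewrite rmorph0 add0r mulrC; exact: IO.
- by exists (x' + y'); have := ID _ _ Ix Iy; congr I; ring.
- by exists (r * x'); have := IR r _ Ix; congr I; ring.
have [//|x y Ix Iy|r x Ix|x1 [I1 x10 Bmin]] := @principal_ideal B N _ N0.
- by rewrite /B /= rmorphD; exact: ID.
- by rewrite /B /= rmorphM; exact: IR.
have /dvdpP[a ea] : y0 %| x1.
  by apply: Amin; exists 0; rewrite rmorph0 add0r mulrC; exact: IO.
have /dvdpP[k ek] : y0 %| x0.
  have -> : x0 = (x0 + b * y0) + (- b) * y0 by ring.
  apply: dvdp_add; last exact: dvdp_mull.
  apply: Amin; exists (Delta * y0); have := IO _ _ Oeta I0; congr I.
  by ring: eta_sqr.
have a0 : a != 0 by apply: contraNneq x10 => a0; rewrite ea a0 mul0r.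
have y0L : emb L y0 != 0 by rewrite emb_eq0.
have aL : emb L a != 0 by rewrite emb_eq0.
have /dvdpP[c ec] : a %| norm k.
  have : x1 %| y0 * norm k.
    apply: Bmin; rewrite /B /=.
    have Ok : order_eta eta (eta + emb L (k + b)) by exists (k + b), 1; ring.
    have := IO _ _ Ok I0; congr I; rewrite ek.
    transitivity (emb L y0 * ((eta + emb L k) * (eta + emb L (k + b)))).
      by ring.
    by rewrite norm_conj rmorphM.
  by rewrite ea mulrC dvdp_mul2l.
have ac : a * c = norm k by rewrite ec mulrC.
have lt := lead_tau ac.
have eI : I = lattice (emb L x1) (emb L x0 + emb L y0 * eta).
  apply/seteqP; split=> v; last by move=> [x [y ->]]; apply: ID; exact: IR.
  move=> Iv; have [x [y e]] : order_eta eta v by case: Iv => w Mw <-; exact: dM.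
  have /dvdpP[m em] : y0 %| y.
    by apply: Amin; exists x; move: Iv; rewrite e; congr I; ring.
  have /dvdpP[n en] : x1 %| x - m * x0.
    apply: Bmin; have := ID _ _ Iv (IR (- m) _ I0); congr I.
    by rewrite e em; ring.
  exists n, m; rewrite e em -(subrK (m * x0) x) en; ring.
exists a, c, k, (d^-1 * (emb L y0 * emb L a)); split=> //.
  by rewrite !mulf_neq0 ?invr_eq0.
have -> : M = [set d^-1 * z | z in I].
  by rewrite image_mulM mulVf // image_mul1.
rewrite -image_mulM lattice_scale mulr1 -mulrA lt eI ea ek; congr image.
by congr lattice; ring.
Qed.

(** * Invertible ideals *)

Lemma ideal_mul_mem (M N : set L) u v : M u -> N v -> ideal_mul M N (u * v).
Proof.
by move=> Mu Nv; exists 1%N, (fun=> u), (fun=> v); split=> //; rewrite big_ord1.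
Qed.

Lemma ideal_mul_add (M N : set L) z w :
  ideal_mul M N z -> ideal_mul M N w -> ideal_mul M N (z + w).
Proof.
move=> [m [u [v [Mu Nv ->]]]] [n [u' [v' [Mu' Nv' ->]]]].
exists (m + n)%N.
exists (fun i => match fintype.split i with inl j => u j | inr j => u' j end).
exists (fun i => match fintype.split i with inl j => v j | inr j => v' j end).
split=> [i|i|]; try by case: (fintype.split i).
rewrite big_split_ord /=; congr (_ + _); apply: eq_bigr => i _.
  by rewrite (unsplitK (inl _ i)).
by rewrite (unsplitK (inr _ i)).
Qed.

Lemma ideal_mul_sub (M N P : set L) :
    P 0 -> (forall z w, P z -> P w -> P (z + w)) ->
    (forall u v, M u -> N v -> P (u * v)) ->
  ideal_mul M N `<=` P.
Proof.
move=> P0 PD Pmul _ [m [u [v [Mu Nv ->]]]].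
by elim/big_ind: _ => // i _; exact: Pmul.
Qed.

Lemma ideal_mul_stable (M N : set L) o z :
    (forall u, M u -> M (o * u)) -> ideal_mul M N z -> ideal_mul M N (o * z).
Proof.
move=> oM [m [u [v [Mu Nv ->]]]]; exists m, (fun i => o * u i), v.
split=> // [i|]; first exact: oM.
by rewrite mulr_sumr; apply: eq_bigr => i _; rewrite mulrA.
Qed.

(** A multiplier of M also stabilizes M N = R + R eta, which contains 1. *)
Lemma invertible_multipliers (M : set L) :
  invertible eta M -> multipliers_integral M.
Proof.
move=> [N _ MN] theta hM; rewrite -[theta]mulr1 -MN.
by apply: ideal_mul_stable => //; rewrite MN -(rmorph1 (emb L)); exact: order_emb.
Qed.

(** The inverse is a times the conjugate lattice: the product contains a, c and
    b = a tau + (eta + k + b), whose combinations include 1. *)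
Lemma tau_invertible (a c k : R) : a * c = norm k ->
  no_common_divisor a b c -> invertible eta (lattice 1 (tau a k)).
Proof.
move=> ac /coprime3P[u [v [w e1]]]; have lt := lead_tau ac.
have ac' : emb L a * emb L c = (eta + emb L k) * (eta + emb L (k + b)).
  by rewrite norm_conj -ac rmorphM.
have tc : tau a k * (eta + emb L (k + b)) = emb L c.
  apply: (mulfI (x := emb L a)); first by rewrite emb_eq0 (lead_neq0 ac).
  by rewrite mulrA lt ac'.
have Oeta : order_eta eta (eta + emb L (k + b)) by exists (k + b), 1; ring.
exists (lattice (emb L a) (eta + emb L (k + b))).
  apply: (lattice_fractional (d := 1)).
  - by rewrite emb_eq0 (lead_neq0 ac).
  - exact: oner_neq0.
  - by rewrite -(rmorph1 (emb L)); exact: order_emb.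
  - by rewrite mul1r; exact: order_emb.
  - by rewrite mul1r.
  - by exists (k + b), a; ring2 h2L.
  - exists c, k; rewrite [_ * emb L a]mulrC ac'; ring2 h2L.
apply/seteqP; split.
  apply: ideal_mul_sub.
  - by rewrite -(rmorph0 (emb L)); exact: order_emb.
  - by move=> _ _ [x [y ->]] [z [t ->]]; exists (x + z), (y + t); ring.
  - move=> _ _ [x [y ->]] [z [t ->]].
    exists (x * z * a + x * t * (k + b) + y * z * k + y * t * c),
           (x * t + y * z).
    transitivity (emb L x * emb L z * emb L a
      + emb L x * emb L t * (eta + emb L (k + b))
      + emb L y * emb L z * (emb L a * tau a k)
      + emb L y * emb L t * (tau a k * (eta + emb L (k + b)))); first by ring.
    by rewrite lt tc; ring.
have [_ _ MO _ _] := tau_fractional ac.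
move=> z Oz; rewrite -[z]mulr1; apply: ideal_mul_stable => [t Mt|]; first exact: MO.
pose P := ideal_mul (lattice 1 (tau a k)) (lattice (emb L a) (eta + emb L (k + b))).
have PR r t : P t -> P (emb L r * t).
  apply: ideal_mul_stable => s Ms; apply: MO => //; exact: order_emb.
have Ml := lattice_l 1 (tau a k); have Mr := lattice_r 1 (tau a k).
have Nl := lattice_l (emb L a) (eta + emb L (k + b)).
have Nr := lattice_r (emb L a) (eta + emb L (k + b)).
have Pa : P (emb L a) by rewrite -[X in P X]mul1r; exact: ideal_mul_mem.
have Pc : P (emb L c) by rewrite -tc; exact: ideal_mul_mem.
have Pb : P (emb L b).
  have -> : emb L b = tau a k * emb L a + 1 * (eta + emb L (k + b)).
    by rewrite mulrC lt; ring2 h2L.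
  by apply: ideal_mul_add; exact: ideal_mul_mem.
suff : P 1 by [].
have <- : emb L u * emb L a + emb L v * emb L b + emb L w * emb L c = 1.
  by rewrite -!rmorphM -!rmorphD e1 rmorph1.
by apply: ideal_mul_add; [apply: ideal_mul_add|]; exact: PR.
Qed.

Lemma C2P (X : set (set L)) : C2 b Delta eta X <-> exists a c k : R,
  [/\ a * c = norm k, no_common_divisor a b c &
      X = ideal_class eta (lattice 1 (tau a k))].
Proof.
split=> [[a [k [dv cop eX]]]|[a [c [k [ac cop ->]]]]].
  by exists a, (norm k %/ a), k; split=> //; rewrite mulrC divpK.
exists a, k; rewrite -ac dvdp_mulIl mulrC mulpK ?(lead_neq0 ac) //.
Qed.

Lemma C2_eq_Pic : C2 b Delta eta = Pic eta.
Proof.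
apply/seteqP; split=> X.
  move=> /C2P[a [c [k [ac cop ->]]]]; exists (lattice 1 (tau a k)).
  by split=> //; [exact: tau_fractional ac | exact: tau_invertible ac cop].
move=> [M [fM iM ->]]; apply/C2P.
have [a [c [k [lam [ac lam0 eM]]]]] := fractional_ideal_tau fM.
exists a, c, k; split=> //; last by rewrite eM ideal_class_scale.
apply/(tau_multipliersP ac)/(multipliers_integral_scale _ lam0).
by rewrite -eM; exact: invertible_multipliers.
Qed.

(** * Cubes of coefficients *)

Section Cube.

Variables p1 q1 r1 s1 p2 q2 r2 s2 : R.

Definition bilinear (p q r s : R) : {mpoly R[4]} :=
  let X i : {mpoly R[4]} := 'X_(inord i) in
  mpolyC 4 p * X 0%N * X 2%N + mpolyC 4 q * X 0%N * X 3%N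
  + mpolyC 4 r * X 1%N * X 2%N + mpolyC 4 s * X 1%N * X 3%N.

(** The polynomial identity in the definition of direct composition, for a
    given cube and without the conditions modulo R_b. *)
Definition composes (a1 c1 a2 c2 a3 c3 : R) :=
  let X i : {mpoly R[4]} := 'X_(inord i) in
  eval_form (a1, b, c1) (X 0%N) (X 1%N) * eval_form (a2, b, c2) (X 2%N) (X 3%N)
  = eval_form (a3, b, c3) (bilinear p1 q1 r1 s1) (bilinear p2 q2 r2 s2).

(** The minors of the 2 x 4 matrix with rows (p1, q1, r1, s1) and
    (p2, q2, r2, s2), the two complementary minors (p, s) and (q, r) being
    added up to give b. *)
Definition cube_forms (a1 c1 a2 c2 : R) :=
  [/\ a1 = p1 * q2 + q1 * p2, c1 = r1 * s2 + s1 * r2,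
      a2 = p1 * r2 + r1 * p2, c2 = q1 * s2 + s1 * q2 &
      b = p1 * s2 + s1 * p2 + q1 * r2 + r1 * q2].

Lemma cube_composes (a1 c1 a2 c2 : R) : cube_forms a1 c1 a2 c2 ->
  composes a1 c1 a2 c2 (q2 * r2 + p2 * s2) (q1 * r1 + p1 * s1).
Proof.
move=> [ea1 ec1 ea2 ec2 eb]; rewrite /composes /eval_form /bilinear.
have h2M : 2 = 0 :> {mpoly R[4]}.
  by rewrite -(rmorph_nat (@mpolyC 4 R) 2) h2R rmorph0.
by rewrite eb ea1 ec1 ea2 ec2; ring2 h2M.
Qed.

Lemma composes_values (a1 c1 a2 c2 a3 c3 : R) :
  composes a1 c1 a2 c2 a3 c3 -> forall x y z w : R,
  let l1 := p1 * x * z + q1 * x * w + r1 * y * z + s1 * y * w in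
  let l2 := p2 * x * z + q2 * x * w + r2 * y * z + s2 * y * w in
  (a1 * x ^+ 2 + b * x * y + c1 * y ^+ 2)
    * (a2 * z ^+ 2 + b * z * w + c2 * w ^+ 2)
  = a3 * l1 ^+ 2 + b * l1 * l2 + c3 * l2 ^+ 2.
Proof.
move=> + x y z w l1 l2.
move=> /(congr1 (meval (fun i : 'I_4 => nth 0 [:: x; y; z; w] i))).
rewrite /eval_form /bilinear !(rmorphM, rmorphD, rmorphXn) /=.
by rewrite !mevalC !mevalXU !inordK.
Qed.

(** For fixed x, y the bilinear substitution is linear in z, w. In
    characteristic 2 the middle coefficient of a form gets multiplied by the
    determinant of a linear substitution; cancelling b identifies the
    determinant with the first form, and symmetrically with the second. The
    third form is then determined by its values on (p1, p2) and (q1, q2).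
    The proof carries this out on the values of the identity at vectors of
    zeros and ones. *)
Lemma composes_cube (a1 c1 a2 c2 a3 c3 : R) :
    b != 0 -> a1 != 0 -> composes a1 c1 a2 c2 a3 c3 ->
  [/\ cube_forms a1 c1 a2 c2, a3 = q2 * r2 + p2 * s2 & c3 = q1 * r1 + p1 * s1].
Proof.
move=> b0 a10 /composes_values E.
have values := (mulr1, mulr0, addr0, add0r, expr1n, expr0n).
have := E 1 0 1 0; rewrite /= !values /= => Ep.
have := E 1 0 0 1; rewrite /= !values /= => Eq.
have := E 0 1 1 0; rewrite /= !values /= => Er.
have := E 0 1 0 1; rewrite /= !values /= => Es.
have := E 1 0 1 1; rewrite /= !values /= => Epq.
have := E 0 1 1 1; rewrite /= !values /= => Ers.
have := E 1 1 1 0; rewrite /= !values /= => Epr.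
have := E 1 1 0 1; rewrite /= !values /= => Eqs.
have := E 1 1 1 1; rewrite /= !values /= => Epqrs.
have ea1 : a1 = p1 * q2 + q1 * p2.
  apply: (mulfI b0); transitivity (a1 * (a2 + b + c2) + a1 * a2 + a1 * c2).
    by ring2 h2R.
  by rewrite Epq Ep Eq; ring2 h2R.
have ec1 : c1 = r1 * s2 + s1 * r2.
  apply: (mulfI b0); transitivity (c1 * (a2 + b + c2) + c1 * a2 + c1 * c2).
    by ring2 h2R.
  by rewrite Ers Er Es; ring2 h2R.
have ea2 : a2 = p1 * r2 + r1 * p2.
  apply: (mulfI b0); transitivity ((a1 + b + c1) * a2 + a1 * a2 + c1 * a2).
    by ring2 h2R.
  by rewrite Epr Ep Er; ring2 h2R.
have ec2 : c2 = q1 * s2 + s1 * q2.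
  apply: (mulfI b0); transitivity ((a1 + b + c1) * c2 + a1 * c2 + c1 * c2).
    by ring2 h2R.
  by rewrite Eqs Eq Es; ring2 h2R.
have eb : b = p1 * s2 + s1 * p2 + q1 * r2 + r1 * q2.
  apply: (mulfI b0).
  transitivity ((a1 + b + c1) * (a2 + b + c2) + a1 * a2 + a1 * c2 + c1 * a2
      + c1 * c2 + b * (a1 + c1 + a2 + c2)); first by ring2 h2R.
  rewrite Epqrs Ep Eq Er Es.
  have -> : a1 + c1 + a2 + c2 = (p1 * q2 + q1 * p2) + (r1 * s2 + s1 * r2)
    + (p1 * r2 + r1 * p2) + (q1 * s2 + s1 * q2) by rewrite -ea1 -ec1 -ea2 -ec2.
  by ring2 h2R.
split=> //.
  apply: (mulfI (expf_neq0 2 a10)).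
  transitivity (q2 ^+ 2 * (a1 * a2 + b * p1 * p2) + p2 ^+ 2 * (a1 * c2 + b * q1 * q2)).
    by rewrite Ep Eq ea1; ring2 h2R.
  by rewrite eb ea1 ea2 ec2; ring2 h2R.
apply: (mulfI (expf_neq0 2 a10)).
transitivity (q1 ^+ 2 * (a1 * a2 + b * p1 * p2) + p1 ^+ 2 * (a1 * c2 + b * q1 * q2)).
  by rewrite Ep Eq ea1; ring2 h2R.
by rewrite eb ea1 ea2 ec2; ring2 h2R.
Qed.

(** A common divisor of a3, b, c3 divides a1 a2, a1 c2, c1 a2 and c1 c2,
    which are values of the third form, hence it divides the product of the
    Bezout relations of the first two forms. *)
Lemma cube_primitive (a1 c1 a2 c2 : R) : cube_forms a1 c1 a2 c2 ->
    no_common_divisor a1 b c1 -> no_common_divisor a2 b c2 ->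
  no_common_divisor (q2 * r2 + p2 * s2) b (q1 * r1 + p1 * s1).
Proof.
move=> cube /coprime3P[u1 [v1 [w1 e1]]] /coprime3P[u2 [v2 [w2 e2]]] d d3 db d3'.
have := composes_values (cube_composes cube) => E.
have values := (mulr1, mulr0, addr0, add0r, expr1n, expr0n).
have dv x y : d %| (q2 * r2 + p2 * s2) * x ^+ 2 + b * x * y
    + (q1 * r1 + p1 * s1) * y ^+ 2.
  by rewrite !dvdp_add // -?mulrA dvdp_mulr.
apply: size1_unit.
have -> : 1 = (u1 * a1 + v1 * b + w1 * c1) * (u2 * a2 + v2 * b + w2 * c2).
  by rewrite e1 e2 mulr1.
have -> : (u1 * a1 + v1 * b + w1 * c1) * (u2 * a2 + v2 * b + w2 * c2)
  = u1 * u2 * (a1 * a2) + u1 * w2 * (a1 * c2) + w1 * u2 * (c1 * a2)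
    + w1 * w2 * (c1 * c2)
    + (v1 * (u2 * a2 + v2 * b + w2 * c2) + (u1 * a1 + w1 * c1) * v2) * b.
  by ring.
have dp : d %| a1 * a2 by have := E 1 0 1 0; rewrite /= !values /= => ->.
have dq : d %| a1 * c2 by have := E 1 0 0 1; rewrite /= !values /= => ->.
have dr : d %| c1 * a2 by have := E 0 1 1 0; rewrite /= !values /= => ->.
have ds : d %| c1 * c2 by have := E 0 1 0 1; rewrite /= !values /= => ->.
by rewrite !dvdp_add // dvdp_mull.
Qed.

End Cube.

(** * Products of lattices *)

Lemma ideal_mul_scale (lam mu : L) (M N : set L) :
  ideal_mul [set lam * z | z in M] [set mu * z | z in N]
    = [set lam * mu * z | z in ideal_mul M N].
Proof.
apply/seteqP; split; last first.
  move=> _ [_ [m [u [v [Mu Nv ->]]]] <-].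
  exists m, (fun i => lam * u i), (fun i => mu * v i); split.
  - by move=> i; exists (u i).
  - by move=> i; exists (v i).
  - by rewrite mulr_sumr; apply: eq_bigr => i _; rewrite mulrACA.
apply: ideal_mul_sub.
- exists 0; rewrite ?mulr0 //; exists 0%N, (fun=> 0), (fun=> 0).
  by split=> [[]|[]|] //; rewrite big_ord0.
- move=> _ _ [z Mz <-] [w Mw <-]; exists (z + w); last by rewrite mulrDr.
  exact: ideal_mul_add.
- move=> _ _ [z Mz <-] [w Mw <-]; exists (z * w); last by rewrite mulrACA.
  exact: ideal_mul_mem.
Qed.

Lemma ideal_mul_lattice (t1 t2 z : L) :
  ideal_mul (lattice 1 t1) (lattice 1 t2) z <->
  exists p q r s : R,
    z = emb L p + emb L q * t2 + emb L r * t1 + emb L s * (t1 * t2).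
Proof.
split=> [|[p [q [r [s ->]]]]].
  move: z; apply: ideal_mul_sub.
  - by exists 0, 0, 0, 0; ring.
  - move=> _ _ [p [q [r [s ->]]]] [p' [q' [r' [s' ->]]]].
    by exists (p + p'), (q + q'), (r + r'), (s + s'); ring.
  - move=> _ _ [x [y ->]] [x' [y' ->]].
    by exists (x * x'), (x * y'), (y * x'), (y * y'); ring.
have Me x y : lattice 1 t1 (emb L x + emb L y * t1) by exists x, y; ring.
have -> : emb L p + emb L q * t2 + emb L r * t1 + emb L s * (t1 * t2)
  = (emb L p + emb L r * t1) * 1 + (emb L q + emb L s * t1) * t2 by ring.
apply: ideal_mul_add; apply: ideal_mul_mem => //; first exact: lattice_l.
exact: lattice_r.
Qed.

(** The columns of the cube are the coordinates of lam (1, t2, t1, t1 t2) on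
    (1, t3). They span R + R t3 because the minors of the cube contain a1
    and c1, and b as the sum of two of them, hence generate the unit ideal. *)
Lemma cube_ideals (p1 q1 r1 s1 p2 q2 r2 s2 a1 c1 a2 c2 k1 k2 k3 : R)
    (a3 := q2 * r2 + p2 * s2) (c3 := q1 * r1 + p1 * s1)
    (t1 := tau a1 k1) (t2 := tau a2 k2) (t3 := tau a3 k3)
    (lam := emb L p1 + emb L p2 * t3) :
    cube_forms p1 q1 r1 s1 p2 q2 r2 s2 a1 c1 a2 c2 ->
    no_common_divisor a1 b c1 -> a1 * c1 = norm k1 ->
    k2 = k1 + (q1 * r2 + q2 * r1) -> k3 = k1 + (p2 * s1 + q2 * r1) ->
  [/\ a2 * c2 = norm k2, a3 * c3 = norm k3, lam != 0 &
      [set lam * z | z in ideal_mul (lattice 1 t1) (lattice 1 t2)]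
        = lattice 1 t3].
Proof.
move=> [ea1 ec1 ea2 ec2 eb] /coprime3P[u [v [w e1]]] nrm1 ek2 ek3.
have eD : Delta = a1 * c1 + k1 ^+ 2 + b * k1 by rewrite nrm1; ring2 h2R.
have nrm2 : a2 * c2 = norm k2.
  by rewrite eD ek2 ea1 ec1 ea2 ec2 eb; ring2 h2R.
have nrm3 : a3 * c3 = norm k3.
  by rewrite eD ek3 ea1 ec1 eb /a3 /c3; ring2 h2R.
have lt1 : emb L a1 * t1 = eta + emb L k1 := lead_tau nrm1.
have lt2 : emb L a2 * t2 = eta + emb L k2 := lead_tau nrm2.
have lt3 : emb L a3 * t3 = eta + emb L k3 := lead_tau nrm3.
have a10 := lead_neq0 nrm1.
have a1L : emb L a1 != 0 by rewrite emb_eq0 (lead_neq0 nrm1).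
have a2L : emb L a2 != 0 by rewrite emb_eq0 (lead_neq0 nrm2).
have a3L : emb L a3 != 0 by rewrite emb_eq0 (lead_neq0 nrm3).
have lam0 : lam != 0.
  apply: contraNneq a10 => z; have [] := @tau_coord _ _ _ nrm3 p1 p2 0 0.
    by rewrite -/lam z; ring.
  by move=> z1 z2; rewrite ea1 z1 z2 mul0r mulr0 addr0.
have eDL : emb L Delta = emb L ((p1 * q2 + q1 * p2) * (r1 * s2 + s1 * r2)
    + k1 ^+ 2 + b * k1) by rewrite -ea1 -ec1 -eD.
have ebL := congr1 (emb L) eb.
have lam2 : lam * t2 = emb L q1 + emb L q2 * t3.
  apply: (mulfI a2L); apply: (mulfI a3L).
  transitivity ((emb L p1 * emb L a3 + emb L p2 * (emb L a3 * t3))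
     * (emb L a2 * t2)); first by rewrite /lam; ring.
  transitivity (emb L a2 * (emb L q1 * emb L a3 + emb L q2 * (emb L a3 * t3)));
    last by ring.
  rewrite lt2 lt3 ek2 ek3 ea2 /a3.
  by ring2 h2L eta_sqr eDL ebL.
have mul_t1 x y x' y' :
    (emb L x * emb L a3 + emb L y * (eta + emb L k3)) * (eta + emb L k1)
      = emb L a1 * (emb L x' * emb L a3 + emb L y' * (eta + emb L k3)) ->
    (emb L x + emb L y * t3) * t1 = emb L x' + emb L y' * t3.
  move=> e; apply: (mulfI a1L); apply: (mulfI a3L).
  transitivity ((emb L x * emb L a3 + emb L y * (emb L a3 * t3))
     * (emb L a1 * t1)); first by ring.
  by rewrite lt1 lt3 e -lt3; ring.
have lam1 : lam * t1 = emb L r1 + emb L r2 * t3.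
  by apply: mul_t1; rewrite ek3 ea1 /a3; ring2 h2L eta_sqr eDL ebL.
have lam12 : lam * (t1 * t2) = emb L s1 + emb L s2 * t3.
  rewrite [t1 * t2]mulrC mulrA lam2.
  by apply: mul_t1; rewrite ek3 ea1 /a3; ring2 h2L eta_sqr eDL ebL.
split=> //; apply/seteqP; split=> [_ [_ /ideal_mul_lattice[p [q [r [s ->]]]] <-]|].
  exists (p * p1 + q * q1 + r * r1 + s * s1), (p * p2 + q * q2 + r * r2 + s * s2).
  transitivity (emb L p * lam + emb L q * (lam * t2) + emb L r * (lam * t1)
    + emb L s * (lam * (t1 * t2))); first by ring.
  by rewrite lam1 lam2 lam12 /lam; ring.
(* Cramer: each minor m times x + y t3 is an explicit combination of the two
   columns defining m; the Bezout relation adds these up. *)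
move=> _ [x [y ->]].
pose P := x * p2 + y * p1; pose Q := x * q2 + y * q1.
pose U := x * r2 + y * r1; pose S := x * s2 + y * s1.
exists (emb L (u * Q + v * S) + emb L (u * P + v * U) * t2
  + emb L (w * S + v * Q) * t1 + emb L (w * U + v * P) * (t1 * t2)).
  apply/ideal_mul_lattice.
  by exists (u * Q + v * S), (u * P + v * U), (w * S + v * Q), (w * U + v * P).
transitivity (emb L (u * Q + v * S) * lam + emb L (u * P + v * U) * (lam * t2)
  + emb L (w * S + v * Q) * (lam * t1) + emb L (w * U + v * P) * (lam * (t1 * t2))).
  by ring.
transitivity (emb L (u * a1 + v * b + w * c1) * (emb L x + emb L y * t3)).
  rewrite lam1 lam2 lam12 /lam ea1 ec1 [in RHS]eb /P /Q /U /S; ring2 h2L.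
by rewrite e1 rmorph1; ring.
Qed.

(** Let t be such that the product of the two lattices is mu (R + R t), and
    write 1, t2, t1, t1 t2 on the basis (mu, mu t). Up to one common factor,
    the minors of the resulting 2 x 4 matrix are the determinants of pairs
    among 1, t2, t1, t1 t2 on (1, eta), that is a1, a2, c1, c2, b + k1 + k2,
    k1 + k2. The minors generate the unit ideal because the four elements
    span the product, the determinants because a1, b, c1 are coprime; so the
    common factor is a unit, which is absorbed in the second row. *)
Lemma product_cube (a1 c1 k1 a2 c2 k2 : R) :
    a1 * c1 = norm k1 -> a2 * c2 = norm k2 ->
    no_common_divisor a1 b c1 ->
  exists p1 q1 r1 s1 p2 q2 r2 s2 : R,
    cube_forms p1 q1 r1 s1 p2 q2 r2 s2 a1 c1 a2 c2
    /\ k1 + k2 = q1 * r2 + q2 * r1.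
Proof.
move=> nrm1 nrm2 /coprime3P[u1 [v1 [w1 e1]]].
have a10 := lead_neq0 nrm1; have a20 := lead_neq0 nrm2.
pose t1 := tau a1 k1; pose t2 := tau a2 k2.
have lt1 : emb L a1 * t1 = eta + emb L k1 := lead_tau nrm1.
have lt2 : emb L a2 * t2 = eta + emb L k2 := lead_tau nrm2.
pose M := ideal_mul (lattice 1 t1) (lattice 1 t2).
have memM := ideal_mul_lattice t1 t2.
have fM : fractional_ideal eta M.
  have [_ _ M1O _ _] := tau_fractional nrm1.
  split.
  - by apply/memM; exists 0, 0, 0, 0; ring.
  - exact: ideal_mul_add.
  - by move=> o z Oo; apply: ideal_mul_stable => z' Mz'; exact: M1O.
  - exists 1; last exact: oner_neq0.
    by apply/memM; exists 1, 0, 0, 0; ring.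
  exists (emb L (a1 * a2)); split; first exact: order_emb.
    by rewrite emb_eq0 mulf_neq0.
  move=> z /memM[p [q [r [s ->]]]].
  exists (p * a1 * a2 + q * a1 * k2 + r * a2 * k1 + s * (Delta + k1 * k2)),
    (q * a1 + r * a2 + s * (b + k1 + k2)).
  transitivity (emb L p * emb L a1 * emb L a2 + emb L q * emb L a1 * (emb L a2 * t2)
    + emb L r * emb L a2 * (emb L a1 * t1)
    + emb L s * ((emb L a1 * t1) * (emb L a2 * t2))); first by ring.
  by rewrite lt1 lt2; ring: eta_sqr.
have [a [c [k [mu [ac mu0 eM]]]]] := fractional_ideal_tau fM.
pose t := tau a k; have lt : emb L a * t = eta + emb L k := lead_tau ac.
have a0 := lead_neq0 ac; pose lam := mu^-1.
have in_lat z : M z -> exists x y, lam * z = emb L x + emb L y * t.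
  rewrite eM => -[_ [x [y ->]] <-]; exists x, y.
  by rewrite mulrA mulVf // /t; ring.
have [p1 [p2]] : exists x y, lam * 1 = emb L x + emb L y * t.
  by apply: in_lat; apply/memM; exists 1, 0, 0, 0; ring.
rewrite mulr1 => lam0.
have [q1 [q2 lam2]] : exists x y, lam * t2 = emb L x + emb L y * t.
  by apply: in_lat; apply/memM; exists 0, 1, 0, 0; ring.
have [r1 [r2 lam1]] : exists x y, lam * t1 = emb L x + emb L y * t.
  by apply: in_lat; apply/memM; exists 0, 0, 1, 0; ring.
have [s1 [s2 lam12]] : exists x y, lam * (t1 * t2) = emb L x + emb L y * t.
  by apply: in_lat; apply/memM; exists 0, 0, 0, 1; ring.
pose u := p1 * a + p2 * k; pose v := p2.
have uv : emb L a * lam = emb L u + emb L v * eta.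
  rewrite lam0 mulrDr mulrCA lt /u /v; ring.
have expand x y z : z = emb L x + emb L y * t ->
    emb L a * z = emb L (x * a + y * k) + emb L y * eta.
  by move=> ->; rewrite mulrDr mulrCA lt; ring.
have [x2 y2] : v * Delta + u * k2 = a2 * (q1 * a + q2 * k)
    /\ u + v * (k2 + b) = a2 * q2.
  apply: eta_coord.
  transitivity ((emb L a * lam) * (emb L a2 * t2)).
    by rewrite uv lt2; ring: eta_sqr.
  transitivity (emb L a2 * (emb L a * (lam * t2))); first by ring.
  by rewrite (expand _ _ _ lam2); ring.
have [x1 y1] : v * Delta + u * k1 = a1 * (r1 * a + r2 * k)
    /\ u + v * (k1 + b) = a1 * r2.
  apply: eta_coord.
  transitivity ((emb L a * lam) * (emb L a1 * t1)).
    by rewrite uv lt1; ring: eta_sqr.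
  transitivity (emb L a1 * (emb L a * (lam * t1))); first by ring.
  by rewrite (expand _ _ _ lam1); ring.
have [x3 y3] : u * (Delta + k1 * k2) + v * Delta * (b + k1 + k2)
      = a1 * a2 * (s1 * a + s2 * k)
    /\ u * (b + k1 + k2) + v * (Delta + k1 * k2) + v * b * (b + k1 + k2)
      = a1 * a2 * s2.
  apply: eta_coord.
  transitivity ((emb L a * lam) * ((emb L a1 * t1) * (emb L a2 * t2))).
    by rewrite uv lt1 lt2; ring: eta_sqr.
  by transitivity (emb L a1 * emb L a2 * (emb L a * (lam * (t1 * t2))));
    [ring | rewrite (expand _ _ _ lam12); ring].
(* Multiplication by u + v eta multiplies determinants on (1, eta) by its
   norm N, while E is the factor coming from the denominators a1, a2 and a. *)
pose N := u ^+ 2 + b * u * v + Delta * v ^+ 2.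
pose E := a1 * a2 * a.
have E0 : E != 0 by rewrite !mulf_neq0.
have m12 : N * a1 = E * (p1 * q2 + q1 * p2).
  transitivity (a1 * (u * (u + v * (k2 + b)) + v * (v * Delta + u * k2))).
    by rewrite /N; ring2 h2R.
  by rewrite x2 y2 /u /v /E; ring2 h2R.
have m13 : N * a2 = E * (p1 * r2 + r1 * p2).
  transitivity (a2 * (u * (u + v * (k1 + b)) + v * (v * Delta + u * k1))).
    by rewrite /N; ring2 h2R.
  by rewrite x1 y1 /u /v /E; ring2 h2R.
have m23 : N * (k1 + k2) = E * (q1 * r2 + q2 * r1).
  transitivity ((v * Delta + u * k1) * (u + v * (k2 + b))
    + (v * Delta + u * k2) * (u + v * (k1 + b))); first by rewrite /N; ring2 h2R.
  by rewrite x1 y1 x2 y2 /E; ring2 h2R.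
have m14 : N * (b + k1 + k2) = E * (p1 * s2 + s1 * p2).
  transitivity (u * (u * (b + k1 + k2) + v * (Delta + k1 * k2) + v * b * (b + k1 + k2))
     + v * (u * (Delta + k1 * k2) + v * Delta * (b + k1 + k2))).
    by rewrite /N; ring2 h2R.
  by rewrite x3 y3 /u /v /E; ring2 h2R.
have m34 : N * c1 = E * (r1 * s2 + s1 * r2).
  apply: (mulfI a10).
  transitivity ((v * Delta + u * k1)
     * (u * (b + k1 + k2) + v * (Delta + k1 * k2) + v * b * (b + k1 + k2))
    + (u + v * (k1 + b)) * (u * (Delta + k1 * k2) + v * Delta * (b + k1 + k2))).
    by rewrite mulrCA nrm1 /N; ring2 h2R.
  by rewrite x1 y1 x3 y3 /E; ring2 h2R.
have m24 : N * c2 = E * (q1 * s2 + s1 * q2).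
  apply: (mulfI a20).
  transitivity ((v * Delta + u * k2)
     * (u * (b + k1 + k2) + v * (Delta + k1 * k2) + v * b * (b + k1 + k2))
    + (u + v * (k2 + b)) * (u * (Delta + k1 * k2) + v * Delta * (b + k1 + k2))).
    by rewrite mulrCA nrm2 /N; ring2 h2R.
  by rewrite x2 y2 x3 y3 /E; ring2 h2R.
(* The four columns span, so their minors have a Bezout relation (Cauchy-
   Binet). *)
have in_M x y : exists g : R * R * R * R, let: (p, q, r, s) := g in
    x = p * p1 + q * q1 + r * r1 + s * s1
    /\ y = p * p2 + q * q2 + r * r2 + s * s2.
  have /memM[p [q [r [s e]]]] : M (mu * (emb L x + emb L y * t)).
    by rewrite eM; exists (emb L x + emb L y * t) => //; exists x, y; rewrite mulr1.
  exists (p, q, r, s); apply: (tau_coord ac).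
  transitivity (lam * (mu * (emb L x + emb L y * t))); first by rewrite mulKf.
  rewrite e; transitivity (emb L p * lam + emb L q * (lam * t2)
    + emb L r * (lam * t1) + emb L s * (lam * (t1 * t2))); first by ring.
  by rewrite lam1 lam2 lam12 lam0 /t; ring.
have [[[[p q] r] s] [g1 g2]] := in_M 1 0.
have [[[[p' q'] r'] s'] [g3 g4]] := in_M 0 1.
pose X := u1 * (p1 * q2 + q1 * p2) + v1 * (p1 * s2 + s1 * p2 + (q1 * r2 + q2 * r1))
  + w1 * (r1 * s2 + s1 * r2).
have NX : N = E * X.
  transitivity (u1 * (N * a1) + v1 * (N * (b + k1 + k2) + N * (k1 + k2))
    + w1 * (N * c1)).
    transitivity (N * (u1 * a1 + v1 * b + w1 * c1)); first by rewrite e1 mulr1.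
    by ring2 h2R.
  by rewrite m12 m14 m23 m34 /X; ring.
pose Y := a1 * (p * q' + q * p') + a2 * (p * r' + r * p')
  + (b + k1 + k2) * (p * s' + s * p') + (k1 + k2) * (q * r' + r * q')
  + c2 * (q * s' + s * q') + c1 * (r * s' + s * r').
have EY : E = N * Y.
  transitivity (N * a1 * (p * q' + q * p') + N * a2 * (p * r' + r * p')
    + N * (b + k1 + k2) * (p * s' + s * p') + N * (k1 + k2) * (q * r' + r * q')
    + N * c2 * (q * s' + s * q') + N * c1 * (r * s' + s * r')); last by rewrite /Y; ring.
  rewrite m12 m13 m14 m23 m24 m34.
  transitivity (E * ((p * p1 + q * q1 + r * r1 + s * s1)
      * (p' * p2 + q' * q2 + r' * r2 + s' * s2)
    + (p * p2 + q * q2 + r * r2 + s * s2)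
      * (p' * p1 + q' * q1 + r' * r1 + s' * s1))); last by ring2 h2R.
  by rewrite -g1 -g2 -g3 -g4 mulr1 mul0r addr0 mulr1.
have XY : X * Y = 1.
  by apply: (mulfI E0); rewrite mulrA -NX -EY mulr1.
have unscale m m' : N * m = E * m' -> m = Y * m'.
  rewrite NX -mulrA => /(mulfI E0) <-.
  by rewrite mulrA [Y * X]mulrC XY mul1r.
exists p1, q1, r1, s1, (Y * p2), (Y * q2), (Y * r2), (Y * s2).
split; last by rewrite (unscale _ _ m23); ring.
split.
- by rewrite (unscale _ _ m12); ring.
- by rewrite (unscale _ _ m34); ring.
- by rewrite (unscale _ _ m13); ring.
- by rewrite (unscale _ _ m24); ring.
transitivity ((b + k1 + k2) + (k1 + k2)); first by ring2 h2R.
by rewrite (unscale _ _ m14) (unscale _ _ m23); ring.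
Qed.

Section ProperClasses.

Variable G : {set F}.
Hypothesis G_zmod : zmod_closed G.
Hypothesis G_one : 1 \notin G.
Hypothesis G_index2 : (#|F| = 2 * #|G|)%N.
Hypothesis b_neq0 : b != 0.

(** * The orientation by R_b *)

Lemma Rsub_add (u v : R) : Rsub G b u -> Rsub G b v -> Rsub G b (u + v).
Proof.
move=> [q [r [-> rb qG]]] [q' [r' [-> rb' qG']]].
exists (q + q'), (r + r'); split; first by ring.
  by apply: leq_ltn_trans (size_polyD _ _) _; rewrite gtn_max rb rb'.
case: G_zmod => G0 GB.
suff -> : (q + q').[0] = q.[0] - (0 - q'.[0]) by rewrite !GB.
by rewrite hornerD sub0r opprK.
Qed.

Lemma G_add (x y : F) : x \in G -> y \in G -> x + y \in G.
Proof.
case: G_zmod => G0 GB xG yG.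
suff -> : x + y = x - (0 - y) by rewrite !GB.
by rewrite sub0r opprK.
Qed.

Lemma G_dichotomy (x : F) : (x \in G) || (x + 1 \in G).
Proof.
have inj1 : injective (fun y : F => y + 1) by exact: addIr.
have dis : (G :&: (+%R^~ 1) @: G)%SET = finset.set0.
  apply/finset.setP => y; rewrite !finset.inE.
  apply/negP => /andP[yG /imsetP[z zG e]]; move: G_one; apply/negP/negPn.
  suff -> : 1 = y + z by exact: G_add.
  by rewrite e; ring2 char2.
have : (G :|: (+%R^~ 1) @: G)%SET = finset.setT.
  apply/eqP; rewrite eqEcard finset.subsetT cardsT G_index2 cardsU.
  by rewrite dis cards0 subn0 card_imset // mul2n addnn leqnn.
move/finset.setP/(_ x); rewrite !finset.inE => /orP[->//|/imsetP[z zG ->]].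
suff -> : z + 1 + 1 = z by rewrite zG orbT.
by ring2 char2.
Qed.

Lemma Rsub_dichotomy (u : R) : Rsub G b u \/ Rsub G b (u + b).
Proof.
have e := divp_eq u b; have sz : (size (u %% b)%R < size b)%N by rewrite ltn_modp.
have [qG|qG] := orP (G_dichotomy (u %/ b).[0]).
  by left; exists (u %/ b), (u %% b).
right; exists (u %/ b + 1), (u %% b); split=> //.
  by rewrite [in LHS]e; ring.
by rewrite hornerD hornerC.
Qed.

Lemma Rsub_b : ~ Rsub G b b.
Proof.
move=> [q [r [e rb qG]]]; move: G_one; apply/negP/negPn.
suff <- : q.[0] = 1 by [].
have -> : q = 1; last by rewrite hornerC.
rewrite -(divpp b_neq0) [X in X %/ _]e divp_addl_mul // divp_small //.
by rewrite addr0.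
Qed.

(** norm k = norm k' means k' = k or k' = k + b, and b is not in R_b. *)
Lemma norm_inj (k k' : R) :
  Rsub G b k -> Rsub G b k' -> norm k = norm k' -> k = k'.
Proof.
move=> Gk Gk' e; apply: (eq_addr2 h2R); apply/eqP.
have : (k + k') * (k + k' + b) == 0.
  apply/eqP; transitivity (norm k + norm k'); first by ring2 h2R.
  by rewrite e; exact: addrr2.
rewrite mulf_eq0 => /orP[//|/eqP kb].
case: Rsub_b; have := Rsub_add Gk Gk'.
by rewrite (eq_addr2 h2R kb).
Qed.

(** * Forms attached to an ideal class *)

(** The map Pi: the value at a class is the set of all primitive forms whose
    oriented lattice lies in the class.  No representative is chosen, so only
    the fact that this set is a single proper class remains to be shown. *)
Definition forms_of_class (X : set (set L)) : set (bqform F) :=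
  [set f | exists a c k : R,
     [/\ f = (a, b, c), Rsub G b k, a * c = norm k, no_common_divisor a b c
       & X = ideal_class eta (lattice 1 (tau a k))]].

(** For equivalent forms, the element required to be in R_b is the difference of
    the two parameters, so oriented homothetic lattices are the same as properly
    equivalent forms. *)
Lemma forms_of_class_tau (a c k : R) :
    Rsub G b k -> a * c = norm k -> no_common_divisor a b c ->
  forms_of_class (ideal_class eta (lattice 1 (tau a k)))
    = form_class G (a, b, c).
Proof.
move=> Gk ac prim; apply/seteqP; split=> [_ [a' [c' [k' [-> Gk' ac' prim' e]]]]|].
  have [lam _ elam] := ideal_class_eqP (tau_fractional ac') e.
  have [p [q [r [s [det1 ea ec ek]]]]] := scaling_unimodular ac ac' elam.
  split=> //; exists (\matrix_(i, j) if i == 0 then if j == 0 then p else q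
                                     else if j == 0 then r else s).
  split; rewrite /= ?mxE //=; first by rewrite det_mx22 !mxE /=; rewrite -det1; ring2 h2R.
    by rewrite -ea -ec.
  suff -> : a * p * r + b * q * r + c * q * s = k + k' by exact: Rsub_add.
  by rewrite ek; ring2 h2R.
move=> [[a' b'] c'] [_ prim' [g [det1]]] /= [ea eb ec] Gg; subst b'.
have det1' : g 0 0 * g 1 1 + g 0 1 * g 1 0 = 1.
  by rewrite -det1 det_mx22; ring2 h2R.
have [nrm lam0 elat] := change_basis ac det1'.
exists a', c', (k + (a * g 0 0 * g 1 0 + b * g 0 1 * g 1 0 + c * g 0 1 * g 1 1)).
split=> //; first exact: Rsub_add.
  by rewrite -nrm ea ec.
by rewrite elat ideal_class_scale // ea.
Qed.

Lemma C2_proper (X : set (set L)) : C2 b Delta eta X -> exists a c k : R,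
  [/\ Rsub G b k, a * c = norm k, no_common_divisor a b c &
      X = ideal_class eta (lattice 1 (tau a k))].
Proof.
move=> /C2P[a [c [k [ac cop ->]]]]; have [Gk|Gk] := Rsub_dichotomy k.
  by exists a, c, k.
exists c, a, (k + b); split=> //.
- by rewrite mulrC ac norm_shift.
- by move=> d dc db da; exact: cop.
by rewrite (tau_swap ac) ideal_class_scale // (tau_neq0 ac).
Qed.

Lemma forms_of_class_CForms (X : set (set L)) :
  C2 b Delta eta X -> CForms G b Delta (forms_of_class X).
Proof.
move=> /C2_proper[a [c [k [Gk ac cop ->]]]]; exists a, c; split=> //.
  by exists k => //; rewrite /phi ac; ring.
exact: forms_of_class_tau.
Qed.

Lemma forms_of_class_inj :
  {in C2 b Delta eta &, injective (forms_of_class)}.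
Proof.
move=> X Y /[!inE] /C2_proper[a [c [k [Gk ac cop eX]]]] _ eXY.
have : forms_of_class X (a, b, c) by exists a, c, k.
rewrite eXY => -[a' [c' [k' [[ea ec] Gk' ac' _ ->]]]].
by rewrite eX -ea (norm_inj Gk Gk') // -ac -ac' ea ec.
Qed.

Lemma forms_of_class_surj :
  set_surj (C2 b Delta eta) (CForms G b Delta) (forms_of_class).
Proof.
move=> _ [a [c [cop [t _ et] ->]]].
have ac : a * c = norm t.
  by apply: (addIr (- Delta)); rewrite -et /phi; ring.
suff [k [Gk ack]] : exists k, Rsub G b k /\ a * c = norm k.
  exists (ideal_class eta (lattice 1 (tau a k))); first by apply/C2P; exists a, c, k.
  exact: forms_of_class_tau.
have [Gt|Gt] := Rsub_dichotomy t; first by exists t.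
by exists (t + b); rewrite norm_shift.
Qed.

(** * Composition and multiplication *)

(** The conditions modulo R_b identify the parameter of the second form with
    k1 + (q1 r2 + q2 r1), by uniqueness of parameters in R_b, and put the
    parameter of the third one into R_b. *)
Lemma direct_composition_class (a1 c1 k1 a2 c2 k2 a3 c3 : R) :
    Rsub G b k1 -> a1 * c1 = norm k1 -> no_common_divisor a1 b c1 ->
    Rsub G b k2 -> a2 * c2 = norm k2 -> no_common_divisor a2 b c2 ->
    direct_composition G b a1 c1 a2 c2 a3 c3 ->
  forms_of_class (ideal_class eta
    (ideal_mul (lattice 1 (tau a1 k1)) (lattice 1 (tau a2 k2))))
  = form_class G (a3, b, c3).
Proof.
move=> Gk1 nrm1 cop1 Gk2 nrm2 cop2.
move=> [p1 [q1 [r1 [s1 [p2 [q2 [r2 [s2 [comp G12 G13]]]]]]]]].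
have [cube ea3 ec3] := composes_cube b_neq0 (lead_neq0 nrm1) comp.
have Gk3 := Rsub_add Gk1 G13.
have [nrm2' nrm3 lam0 eI] := cube_ideals cube cop1 nrm1 erefl erefl.
have ek2 : k2 = k1 + (q1 * r2 + q2 * r1).
  by apply: norm_inj => //; [exact: Rsub_add | rewrite -nrm2' -nrm2].
rewrite -ek2 in eI.
rewrite -(ideal_class_scale _ lam0) eI ea3 ec3.
by apply: forms_of_class_tau => //; exact: (cube_primitive cube).
Qed.

(** The first condition holds for the cube of product_cube, as k1 and k2 lie in
    R_b.  Exchanging its two rows keeps the minors and adds b to the element of
    the second condition, so one of the two orders satisfies it. *)
Lemma direct_composition_exists (a1 c1 k1 a2 c2 k2 : R) :
    Rsub G b k1 -> a1 * c1 = norm k1 -> no_common_divisor a1 b c1 ->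
    Rsub G b k2 -> a2 * c2 = norm k2 ->
  exists a3 c3, direct_composition G b a1 c1 a2 c2 a3 c3.
Proof.
move=> Gk1 nrm1 cop1 Gk2 nrm2.
have [p1 [q1 [r1 [s1 [p2 [q2 [r2 [s2 [cube e12]]]]]]]]] :=
  product_cube nrm1 nrm2 cop1.
have G12 := Rsub_add Gk1 Gk2.
have [G13|G13] := Rsub_dichotomy (p2 * s1 + q2 * r1).
  exists (q2 * r2 + p2 * s2), (q1 * r1 + p1 * s1).
  exists p1, q1, r1, s1, p2, q2, r2, s2; split=> //; last by rewrite -e12.
  exact: (cube_composes cube).
have cube' : cube_forms p2 q2 r2 s2 p1 q1 r1 s1 a1 c1 a2 c2.
  case: cube => ea1 ec1 ea2 ec2 eb; split; first [rewrite ea1 | rewrite ec1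
    | rewrite ea2 | rewrite ec2 | rewrite eb]; ring.
exists (q1 * r1 + p1 * s1), (q2 * r2 + p2 * s2).
exists p2, q2, r2, s2, p1, q1, r1, s1; split; first exact: (cube_composes cube').
  by suff -> : q2 * r1 + q1 * r2 = k1 + k2 by []; rewrite e12 addrC.
suff -> : p1 * s2 + q1 * r2 = p2 * s1 + q2 * r1 + b by [].
by case: cube => _ _ _ _ ->; ring2 h2R.
Qed.

Lemma forms_of_class_mul (M1 M2 : set L) :
    C2 b Delta eta (ideal_class eta M1) -> C2 b Delta eta (ideal_class eta M2) ->
  forms_of_class (ideal_class eta (ideal_mul M1 M2))
    = class_mul G b (forms_of_class (ideal_class eta M1))
                    (forms_of_class (ideal_class eta M2)).
Proof.
have prodE a1 c1 k1 a2 c2 k2 : a1 * c1 = norm k1 -> a2 * c2 = norm k2 ->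
    ideal_class eta M1 = ideal_class eta (lattice 1 (tau a1 k1)) ->
    ideal_class eta M2 = ideal_class eta (lattice 1 (tau a2 k2)) ->
    ideal_class eta (ideal_mul M1 M2) = ideal_class eta
      (ideal_mul (lattice 1 (tau a1 k1)) (lattice 1 (tau a2 k2))).
  move=> nrm1 nrm2 e1 e2.
  have [lam lam0 ->] := ideal_class_eqP (tau_fractional nrm1) e1.
  have [mu mu0 ->] := ideal_class_eqP (tau_fractional nrm2) e2.
  by rewrite ideal_mul_scale ideal_class_scale // mulf_neq0.
move=> /C2_proper[a1 [c1 [k1 [Gk1 nrm1 cop1 e1]]]].
move=> /C2_proper[a2 [c2 [k2 [Gk2 nrm2 cop2 e2]]]].
apply/seteqP; split=> f.
  have [a3 [c3 comp]] := direct_composition_exists Gk1 nrm1 cop1 Gk2 nrm2.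
  rewrite (prodE _ _ _ _ _ _ nrm1 nrm2 e1 e2).
  rewrite (direct_composition_class Gk1 nrm1 cop1 Gk2 nrm2 cop2 comp) => hf.
  exists a1, c1, a2, c2, a3, c3; split=> //.
    by exists a1, c1, k1.
  by exists a2, c2, k2.
move=> [a1' [c1' [a2' [c2' [a3 [c3 [h1 h2 comp hf]]]]]]].
case: h1 => [x1 [y1 [l1 [[xa ya] Gl1 nl1 copl1 el1]]]]; subst x1 y1.
case: h2 => [x2 [y2 [l2 [[xa ya] Gl2 nl2 copl2 el2]]]]; subst x2 y2.
rewrite (prodE _ _ _ _ _ _ nl1 nl2 el1 el2).
by rewrite (direct_composition_class Gl1 nl1 copl1 Gl2 nl2 copl2 comp).
Qed.

(** The coprimality assumed on one lattice of the class passes to any other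
    of the form R + R (tau a k), through the ring of multipliers. *)
Lemma ratio_class (alpha beta : L) (a k : R) :
    in_C2_with_ratio b Delta eta alpha beta a k ->
  [/\ a * (norm k %/ a) = norm k, no_common_divisor a b (norm k %/ a) &
      ideal_class eta (lattice alpha beta)
        = ideal_class eta (lattice 1 (tau a k))].
Proof.
move=> [free inC2 ratio dv].
have beta0 : beta != 0.
  apply/eqP => beta0; have [] := free 0 1.
    by rewrite beta0 rmorph0 mul0r mulr0 addr0.
  by move=> _ /eqP; rewrite oner_eq0.
have ac : a * (norm k %/ a) = norm k by rewrite mulrC divpK.
have e : lattice alpha beta = [set beta * z | z in lattice 1 (tau a k)].
  by rewrite lattice_scale mulr1 lattice_swap /tau -ratio mulrC divfK.
have [a' [c' [k' [ac' cop' eX]]]] := (C2P _).1 inC2.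
have [lam lam0 elam] := ideal_class_eqP (tau_fractional ac') eX.
split=> //; last by rewrite e ideal_class_scale.
apply/(tau_multipliersP ac)/(multipliers_integral_scale _ beta0).
by rewrite -e elam; apply/multipliers_integral_scale => //; exact/(tau_multipliersP ac').
Qed.

End ProperClasses.

End QuadraticOrder.

(** * The theorem *)

Theorem theorem2p21 (n : nat) (F : finFieldType) (cardF : #|F| = (2 ^ n)%N)
    (G : {set F}) (subgG : zmod_closed G) (cardG : #|G| = (2 ^ n.-1)%N)
    (one_notin_G : 1 \notin G)
    (b Delta : {poly F}) (b_neq0 : b != 0)
    (Delta_notin_phi : ~ range (phi b) Delta)
    (L : fieldExtType {fraction {poly F}}) (eta : L)
    (minpoly_eta : minPoly 1%VS eta
                   = 'X^2 + (emb L b) *: 'X + (emb L Delta)%:P)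
    (L_gen : <<1%VS; eta>>%VS = {:L}%VS) :
  (forall (alpha beta : L) (a k : {poly F}),
     in_C2_with_ratio b Delta eta alpha beta a k ->
     let N := Delta + k ^+ 2 + b * k in
     [/\ beta / alpha = emb L a / (eta + emb L k),
         emb L a / (eta + emb L k)
           = (eta + emb L k + emb L b) / (emb L N / emb L a),
         emb L N / emb L a = emb L (N %/ a) &
         (k \in Rsub G b) (+) (k + b \in Rsub G b)]) /\
  exists Pi : set (set L) -> set (bqform F),
    [/\ forall (alpha beta : L) (a k : {poly F}),
          in_C2_with_ratio b Delta eta alpha beta a k ->
          let c := (Delta + k ^+ 2 + b * k) %/ a in
          (k \in Rsub G b ->
             Pi (ideal_class eta (lattice alpha beta))
               = form_class G (a, b, c)) /\
          (k + b \in Rsub G b ->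
             Pi (ideal_class eta (lattice alpha beta))
               = form_class G (c, b, a)),
        set_bij (C2 b Delta eta) (CForms G b Delta) Pi,
        C2 b Delta eta = Pic eta &
        forall M1 M2 : set L,
          fractional_ideal eta M1 -> fractional_ideal eta M2 ->
          C2 b Delta eta (ideal_class eta M1) ->
          C2 b Delta eta (ideal_class eta M2) ->
          Pi (ideal_class eta (ideal_mul M1 M2))
            = class_mul G b (Pi (ideal_class eta M1))
                            (Pi (ideal_class eta M2))].
Proof.
have char2 : 2 = 0 :> F.
  by apply: pcharf0; exact: (card_finPcharP cardF).
have G_index2 : #|F| = (2 * #|G|)%N.
  case: n cardF cardG => [|m] cF cG; last by rewrite cF cG expnS.
  by have := card_finNzRing_gt1 F; rewrite cF.
have h2L := char2_ext L char2.
have eta_sqr : eta ^+ 2 = emb L b * eta + emb L Delta.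
  have := root_minPoly 1%VS eta; rewrite minpoly_eta /root !hornerE -addrA.
  by move/eqP/(eq_addr2 h2L).
have eta_free : direct_sum 1 eta.
  move=> x y; have [->|y0] := eqVneq y 0.
    by rewrite rmorph0 mul0r addr0 mulr1 => /eqP; rewrite emb_eq0 => /eqP.
  move=> e; have yL : emb L y != 0 by rewrite emb_eq0.
  have emb1 z : emb L z \in 1%VS by rewrite /emb rpredZ // mem1v.
  have eta1 : eta \in 1%VS.
    have -> : eta = - emb L x / emb L y.
      apply: (mulIf yL); rewrite divfK // mulrC; apply/eqP.
      by rewrite -subr_eq0 opprK addrC -[emb L x]mulr1 e.
    by rewrite rpredM ?rpredN ?rpredV.
  have /(congr1 (fun p : {poly L} => p`_2)) := minpoly_eta.
  rewrite (minPoly_XsubC eta1) !coefE /= !(mulr0, addr0, subr0) => /eqP.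
  by rewrite eq_sym oner_eq0.
have dich := Rsub_dichotomy char2 subgG one_notin_G G_index2 b_neq0.
split=> [alpha beta a k hr N|].
  have [ac _ _] := ratio_class char2 eta_sqr eta_free hr.
  have [_ _ ratio _] := hr.
  have a0 := lead_neq0 char2 eta_sqr eta_free ac.
  have aL : emb L a != 0 by rewrite emb_eq0.
  have k0 := eta_emb_neq0 eta_free k.
  have kb0 := eta_emb_neq0 eta_free (k + b).
  have eN : emb L N = (eta + emb L k) * (eta + emb L (k + b)).
    by rewrite (norm_conj char2 eta_sqr).
  split.
  - by rewrite -invf_div ratio invf_div.
  - by rewrite eN; field; rewrite k0 -rmorphD kb0 aL.
  - by apply: (mulIf aL); rewrite divfK // -rmorphM mulrC ac.
  have nb : ~ (Rsub G b k /\ Rsub G b (k + b)).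
    move=> [Gk Gkb]; apply: (Rsub_b one_notin_G b_neq0).
    have := Rsub_add subgG Gk Gkb.
    suff -> : k + (k + b) = b by [].
    by rewrite addrA (addrr2 (char2_poly char2)) add0r.
  have [Gk|Gk] := dich k.
    by rewrite (mem_set Gk) memNset // => Gkb; exact: nb.
  by rewrite (mem_set Gk) memNset // => Gk'; exact: nb.
exists (forms_of_class b Delta eta G); split.
- move=> alpha beta a k hr c.
  have [ac cop ->] := ratio_class char2 eta_sqr eta_free hr.
  split=> /set_mem Gk.
    exact: forms_of_class_tau.
  rewrite (tau_swap char2 eta_sqr eta_free ac) ideal_class_scale.
    apply: forms_of_class_tau => //.
      by rewrite mulrC ac (norm_shift b Delta char2).
    by move=> d dc db da; exact: cop.
  exact: (tau_neq0 char2 eta_sqr eta_free ac).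
- split.
  + by move=> X; exact: forms_of_class_CForms.
  + exact: forms_of_class_inj.
  + exact: forms_of_class_surj.
- exact: C2_eq_Pic.
- by move=> M1 M2 _ _; exact: forms_of_class_mul.
Qed.
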